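(* Let $\alpha>1$ and let $$S(x)=\int_1^x\bigl(1+\cos(\log^\alpha u)\bigr)\,\mathrm{d}u,\qquad x\ge1,$$ which is non-negative and non-decreasing. Its Mellin transform $\int_1^\infty S(x)x^{-s-1}\,\mathrm{d}x$ (for $\operatorname{Re}s>1$) equals $$\frac{1}{s-1}-\frac1s+\frac{F_{\alpha,0}(\mathrm{i}(1-s))+\overline{F_{\alpha,0}(\mathrm{i}(1-\overline{s}))}}{2s},$$ and after subtraction of $1/(s-1)$ it admits an analytic extension to the half-plane $\operatorname{Re}s>0$. On the other hand, as $x\to\infty$, $$S(x)=x+\frac{x\sin(\log^\alpha x)}{\alpha\log^{\alpha-1}x}+O\Bigl(\frac{x}{\log^{2(\alpha-1)}x}\Bigr).$$ Consequently, $S$ disproves the following conjecture: for $0<\sigma_0<1$, every non-negative non-decreasing function $S$ on $[1,\infty)$ such that $\int_1^\infty S(x)x^{-s-1}\,\mathrm{d}x-\frac{A}{s-1}$ admits an analytic extension to $\operatorname{Re}s>\sigma_0$ for some constant $A$ satisfies $S(x)=Ax+O\bigl(x^{\frac{\sigma_0+2}{3}+\varepsilon}\bigr)$ for each $\varepsilon>0$.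
   Context: $F_{\alpha,0}(z)=\int_0^\infty\exp(\mathrm{i}t^\alpha-\mathrm{i}zt)\,\mathrm{d}t$ for $\operatorname{Im}z<0$; this function extends to an entire function, also denoted $F_{\alpha,0}$. $\log^\alpha u$ means $(\log u)^\alpha$. *)

(* Defs.v *)
From Stdlib Require Import Reals.
From Coquelicot Require Import Coquelicot.
Open Scope R_scope.

(* [Rpower 0 a] is [1] because of the junk value [ln 0 = 0]; for the exponents
   [a > 0] used below the value at base [0] has to be [0]. *)
Definition rpow (u a : R) : R := if Rlt_dec 0 u then Rpower u a else 0.

Definition Cexp (z : C) : C :=
  (exp (Re z) * cos (Im z), exp (Re z) * sin (Im z)).

(* x ^ w for x > 0 and complex w, principal branch. *)
Definition cpow (x : R) (w : C) : C := Cexp (w * RtoC (ln x))%C.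

Definition holomorphic_on (D : C -> Prop) (f : C -> C) : Prop :=
  forall z : C, D z -> ex_derive (K := C_AbsRing) (V := C_NormedModule) f z.

Definition entire (f : C -> C) : Prop := holomorphic_on (fun _ => True) f.

(* The integral of f over [a, +oo) converges, with value l. *)
Definition is_RInt_infty (f : R -> C) (a : R) (l : C) : Prop :=
  is_RInt_gen (V := C_R_NormedModule) f (at_point a) (Rbar_locally p_infty) l.

(* F is the entire function F_{alpha,0}; the values for Im z < 0 determine it. *)
Definition is_F0 (alpha : R) (F : C -> C) : Prop :=
  entire F /\
  forall z : C, Im z < 0 ->
    is_RInt_infty
      (fun t : R => Cexp (Ci * RtoC (rpow t alpha) - Ci * z * RtoC t)%C) 0 (F z).

Definition S_alpha (alpha : R) (x : R) : R :=
  RInt (fun u : R => 1 + cos (rpow (ln u) alpha)) 1 x.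

Definition is_Mellin (S : R -> R) (s l : C) : Prop :=
  is_RInt_infty (fun x : R => (RtoC (S x) * cpow x (- s - 1))%C) 1 l.

Definition nonneg_from1 (S : R -> R) : Prop := forall x : R, 1 <= x -> 0 <= S x.

Definition nondecr_from1 (S : R -> R) : Prop :=
  forall x y : R, 1 <= x -> x <= y -> S x <= S y.

(* The Mellin transform of S converges for Re s > 1 and, after subtraction of
   A / (s - 1), extends analytically to Re s > sigma. *)
Definition Mellin_extends (S : R -> R) (A sigma : R) : Prop :=
  exists G : C -> C,
    holomorphic_on (fun s => sigma < Re s) G /\
    forall s : C, 1 < Re s ->
      exists l : C, is_Mellin S s l /\ G s = (l - RtoC A / (s - 1))%C.

(* f(x) = O(g(x)) as x -> +oo. *)
Definition bigO_infty (f g : R -> R) : Prop :=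
  exists K : R, Rbar_locally p_infty (fun x => Rabs (f x) <= K * Rabs (g x)).

Definition tauberian_hyp (sigma0 : R) (S : R -> R) (A : R) : Prop :=
  nonneg_from1 S /\ nondecr_from1 S /\ Mellin_extends S A sigma0.

Definition tauberian_concl (sigma0 : R) (S : R -> R) (A : R) : Prop :=
  forall eps : R, 0 < eps ->
    bigO_infty (fun x => S x - A * x)
               (fun x => Rpower x ((sigma0 + 2) / 3 + eps)).

Definition tauberian_conjecture (sigma0 : R) : Prop :=
  forall (S : R -> R) (A : R),
    tauberian_hyp sigma0 S A -> tauberian_concl sigma0 S A.

(* Main.v *)
Require Import Defs.
From Stdlib Require Import Reals Lra Psatz.
From Coquelicot Require Import Coquelicot.
Open Scope R_scope.

(** Write [S] for [S_alpha alpha]. Integrating [S x * x^(-s-1)] by parts and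
    substituting [x = e^t] leaves, besides elementary terms, the integral of
    [cos (t^alpha) e^((1-s)t)] over the half-line. The cosine is the mean of two
    conjugate exponentials, so this integral is the half sum of [F (i (1-s))]
    and of the conjugate of [F (i (1 - conj s))]
    ([Mellin_primitive_derive], [Mellin_primitive_lim]).

    Everything analytic rests on the function [F]. On the real half-line
    [exp (i t^alpha)] only oscillates, but on the ray of argument
    [PI / (2 alpha)] it becomes [exp (- r^alpha)], which beats every exponential
    because [alpha > 1]. The integral along that ray therefore converges for
    every [z], and differentiating under the integral sign shows that it is
    entire ([F_ray_entire]). For [Im z < 0] it agrees with the integral along
    the half-line ([F_ray_agrees]): the integrals over [0, T] along two rays
    differ by the integral along an arc of radius [T], and this tends to 0. In
    place of a contour theorem the angle [th] is used as a homotopy parameter: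
    with [w = r e^(i th)] the functions [U = e^(i th) f(w)] and [V = i r U]
    satisfy [dU/dth = dV/dr], so that the derivative in [th] of the integral of
    [U] over [0, T] is the arc term [V] at [r = T] ([homotopy_bound],
    [ray_rotation]). Since [F] is entire, the formula for the Mellin transform
    without its term [1 / (s - 1)] is holomorphic away from [s = 0].

    For the growth of [S], two integrations by parts in the variable [t = ln x]
    produce an explicit two-term expansion whose error has a derivative of size
    [e^t t^(-2(alpha-1))]; this is at most a constant times the derivative of
    the same function, so the error itself is of this order
    ([S_alpha_expansion_exp]). The conjectured bound would make the oscillating
    term [x sin (log^alpha x) / (alpha log^(alpha-1) x)] smaller than a power
    [x^beta] with [beta < 1] up to the error of the expansion; at the points
    where the sine is 1 this fails, because the loss with respect to [x] is only
    a power of the logarithm ([S_alpha_not_power_close]). *)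

(** * Real powers extended by zero *)

Lemma rpow_pos (u a : R) : 0 < u -> rpow u a = Rpower u a.
Proof. intros H. unfold rpow. destruct (Rlt_dec 0 u); lra. Qed.

Lemma rpow_nonpos (u a : R) : u <= 0 -> rpow u a = 0.
Proof. intros H. unfold rpow. destruct (Rlt_dec 0 u); lra. Qed.

Lemma rpow_ge_0 (u a : R) : 0 <= rpow u a.
Proof.
  unfold rpow. destruct (Rlt_dec 0 u); [ | lra].
  unfold Rpower. left. apply exp_pos.
Qed.

Lemma Rpower_gt_0 (x y : R) : 0 < Rpower x y.
Proof. apply exp_pos. Qed.

Lemma Rpower_root (e a : R) : 0 < e -> a <> 0 -> Rpower (Rpower e (/ a)) a = e.
Proof.
  intros He Ha. rewrite Rpower_mult, Rinv_l by exact Ha. now apply Rpower_1.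
Qed.

Lemma rpow_small (a eps : R) : 0 < a -> 0 < eps ->
  exists d, 0 < d /\ forall u, Rabs u < d -> Rabs (rpow u a) < eps.
Proof.
  intros Ha He. exists (Rpower eps (/ a)). split; [apply Rpower_gt_0 | ].
  intros u Hu. rewrite Rabs_pos_eq by apply rpow_ge_0.
  unfold rpow. destruct (Rlt_dec 0 u) as [H | H]; [ | exact He].
  rewrite <- (Rpower_root eps a He) by lra.
  apply Rlt_Rpower_l; [exact Ha | ].
  rewrite Rabs_pos_eq in Hu by lra. lra.
Qed.

Lemma is_derive_Rpower (u a : R) : 0 < u ->
  is_derive (fun u => Rpower u a) u (a * Rpower u (a - 1)).
Proof.
  intros Hu. unfold Rpower. auto_derive; [exact Hu | ].
  replace ((a - 1) * ln u) with (a * ln u + - ln u) by ring.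
  rewrite exp_plus, exp_Ropp, exp_ln by exact Hu. field. lra.
Qed.

Lemma is_derive_rpow_pos (u a : R) : 0 < u ->
  is_derive (fun u => rpow u a) u (a * rpow u (a - 1)).
Proof.
  intros Hu. rewrite rpow_pos by exact Hu.
  apply is_derive_ext_loc with (fun u => Rpower u a).
  - exists (mkposreal u Hu). intros v Hv. symmetry. apply rpow_pos.
    unfold ball in Hv; simpl in Hv. unfold AbsRing_ball, abs, minus, plus, opp in Hv; simpl in Hv.
    apply Rabs_def2 in Hv. lra.
  - now apply is_derive_Rpower.
Qed.

Lemma is_derive_rpow_neg (u a : R) : u < 0 ->
  is_derive (fun u => rpow u a) u 0.
Proof.
  intros Hu.
  apply is_derive_ext_loc with (fun _ => 0).
  - assert (H : 0 < - u) by lra. exists (mkposreal _ H). intros v Hv. symmetry. apply rpow_nonpos.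
    unfold ball in Hv; simpl in Hv. unfold AbsRing_ball, abs, minus, plus, opp in Hv; simpl in Hv.
    apply Rabs_def2 in Hv. lra.
  - apply is_derive_Reals. apply derivable_pt_lim_const.
Qed.

Lemma continuous_rpow (a u : R) : 0 < a -> continuous (fun u => rpow u a) u.
Proof.
  intros Ha. destruct (Rtotal_order u 0) as [H | [-> | H]].
  - apply (ex_derive_continuous (fun u => rpow u a)). eexists. now apply is_derive_rpow_neg.
  - apply continuity_pt_filterlim. intros eps He.
    destruct (rpow_small a eps Ha He) as [d [Hd Hs]].
    exists d. split; [exact Hd | ]. intros v [_ Hv]. simpl in *. unfold Rdist in *.
    rewrite (rpow_nonpos 0) by lra. rewrite Rminus_0_r in *. now apply Hs.
  - apply (ex_derive_continuous (fun u => rpow u a)). eexists. now apply is_derive_rpow_pos.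
Qed.

Lemma rpow_split (u a : R) : 1 < a -> rpow u a = u * rpow u (a - 1).
Proof.
  intros Ha. unfold rpow. destruct (Rlt_dec 0 u); [ | ring].
  rewrite <- (Rpower_1 u) at 2 by lra. rewrite <- Rpower_plus. f_equal. ring.
Qed.

(** At the base point 0 the hypothesis [1 < a] makes the difference quotient
    [rpow u (a - 1)] tend to 0, so the formula holds on the whole line. *)
Lemma is_derive_rpow (u a : R) : 1 < a ->
  is_derive (fun u => rpow u a) u (a * rpow u (a - 1)).
Proof.
  intros Ha. destruct (Rtotal_order u 0) as [H | [-> | H]].
  - rewrite rpow_nonpos, Rmult_0_r by lra. now apply is_derive_rpow_neg.
  - rewrite rpow_nonpos, Rmult_0_r by lra. apply is_derive_Reals.
    intros eps He. destruct (rpow_small (a - 1) eps) as [d [Hd Hs]]; [lra | exact He | ].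
    exists (mkposreal d Hd). intros h Hh Hhd. simpl in Hhd.
    rewrite Rplus_0_l, (rpow_nonpos 0) by lra.
    rewrite rpow_split by exact Ha.
    replace ((h * rpow h (a - 1) - 0) / h - 0) with (rpow h (a - 1)) by (field; exact Hh).
    now apply Hs.
  - now apply is_derive_rpow_pos.
Qed.

Lemma rpow_superlinear (a B : R) : 1 < a ->
  exists T0, 1 <= T0 /\ forall T, T0 <= T -> B * T <= rpow T a.
Proof.
  intros Ha. set (B' := Rmax B 1).
  exists (Rmax 1 (Rpower B' (/ (a - 1)))). split; [apply Rmax_l | ].
  intros T HT.
  assert (H1 : 1 <= T) by (eapply Rle_trans; [apply Rmax_l | exact HT]).
  assert (H2 : Rpower B' (/ (a - 1)) <= T) by (eapply Rle_trans; [apply Rmax_r | exact HT]).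
  rewrite rpow_split by exact Ha. rewrite Rmult_comm.
  apply Rmult_le_compat_l; [lra | ].
  apply Rle_trans with B'; [apply Rmax_l | ].
  assert (HB : 0 < B') by (apply Rlt_le_trans with 1; [lra | apply Rmax_r]).
  rewrite <- (Rpower_root B' (a - 1) HB) by lra.
  rewrite rpow_pos by lra. apply Rle_Rpower_l; [lra | ]. split; [apply Rpower_gt_0 | exact H2].
Qed.

(** Superlinear growth of [r^a] turns every exponential factor into a mere
    constant; [exp (- r)] serves as the single majorant of all later integrals. *)
Lemma exp_rpow_dominated (a B : R) : 1 < a ->
  exists K, 0 < K /\ forall r, 0 <= r -> exp (- rpow r a + B * r) <= K * exp (- r).
Proof.
  intros Ha. destruct (rpow_superlinear a (Rabs B + 1) Ha) as [T0 [HT0 H]].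
  exists (exp ((Rabs B + 1) * T0)). split; [apply exp_pos | ].
  intros r Hr. rewrite <- exp_plus.
  assert (HB := Rle_abs B). assert (HB' := Rabs_pos B).
  assert (E : - rpow r a + B * r <= (Rabs B + 1) * T0 + - r).
  { destruct (Rle_lt_dec T0 r) as [h | h].
    - specialize (H r h). nra.
    - assert (H3 := rpow_ge_0 r a). nra. }
  destruct E as [E | E]; [left; now apply exp_increasing | right; now rewrite E].
Qed.

(** * Complex-valued functions of a real variable *)

Lemma norm_C_R (z : C) : norm (V := C_R_NormedModule) z = Cmod z.
Proof.
  unfold norm; simpl. unfold prod_norm, Cmod. simpl. unfold norm; simpl. unfold abs; simpl.
  f_equal. rewrite !Rmult_1_r. rewrite <- !Rabs_mult.
  rewrite !Rabs_pos_eq; [reflexivity | apply Rle_0_sqr | apply Rle_0_sqr].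
Qed.

Lemma Cmod_le_abs (z : C) : Cmod z <= Rabs (fst z) + Rabs (snd z).
Proof.
  assert (H1 := Rabs_pos (fst z)). assert (H2 := Rabs_pos (snd z)).
  unfold Cmod. rewrite <- (sqrt_Rsqr (Rabs (fst z) + Rabs (snd z))) by lra.
  apply sqrt_le_1_alt. unfold Rsqr.
  rewrite <- (pow2_abs (fst z)), <- (pow2_abs (snd z)). nra.
Qed.

Lemma Rabs_fst_le_Cmod (z : C) : Rabs (fst z) <= Cmod z.
Proof. eapply Rle_trans; [ | apply Rmax_Cmod]. apply Rmax_l. Qed.

Lemma Rabs_snd_le_Cmod (z : C) : Rabs (snd z) <= Cmod z.
Proof. eapply Rle_trans; [ | apply Rmax_Cmod]. apply Rmax_r. Qed.

Lemma Cmod_Cexp (z : C) : Cmod (Cexp z) = exp (Re z).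
Proof.
  unfold Cexp, Cmod. simpl.
  replace (_ + _) with (exp (Re z) * exp (Re z) * ((sin (Im z))² + (cos (Im z))²)) by (unfold Rsqr; ring).
  rewrite sin2_cos2, Rmult_1_r. apply sqrt_Rsqr. left. apply exp_pos.
Qed.

Lemma Cexp_plus (z w : C) : Cexp (z + w)%C = (Cexp z * Cexp w)%C.
Proof.
  unfold Cexp. rewrite re_plus, im_plus, exp_plus, cos_plus, sin_plus.
  unfold Cmult; simpl. f_equal; ring.
Qed.

Lemma Cexp_conj (z : C) : Cconj (Cexp z) = Cexp (Cconj z).
Proof.
  unfold Cexp, Cconj, Re, Im; simpl. rewrite cos_neg, sin_neg. f_equal. ring.
Qed.

Lemma Cexp_0 : Cexp 0 = 1.
Proof. unfold Cexp, Re, Im; simpl. rewrite exp_0, cos_0, sin_0. unfold RtoC. f_equal; ring. Qed.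

Notation is_deriveC := (is_derive (K := R_AbsRing) (V := C_R_NormedModule)).
Notation continuousC := (@continuous R_UniformSpace C_R_NormedModule).
Notation is_RIntC := (is_RInt (V := C_R_NormedModule)).
Notation RIntC := (RInt (V := C_R_CompleteNormedModule)).

(** Derivatives of curves are computed by components: the curve is
    [f1 * (1, 0) + f2 * (0, 1)]. *)
Lemma is_deriveC_pair (f : R -> C) (x : R) (l : C) :
  is_derive (fun t => fst (f t)) x (fst l) ->
  is_derive (fun t => snd (f t)) x (snd l) -> is_deriveC f x l.
Proof.
  intros H1 H2.
  apply is_derive_ext with
    (fun t => plus (scal (fst (f t)) ((1, 0) : C_R_NormedModule))
                   (scal (snd (f t)) ((0, 1) : C_R_NormedModule))).
  - intros t. destruct (f t) as [u v]. unfold plus, scal; simpl.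
    unfold prod_plus, prod_scal, plus, scal, mult; simpl. unfold mult; simpl. f_equal; ring.
  - replace l with
      (plus (scal (fst l) ((1, 0) : C_R_NormedModule))
            (scal (snd l) ((0, 1) : C_R_NormedModule))).
    + apply (is_derive_plus (V := C_R_NormedModule)); now apply (is_derive_scal_l (V := C_R_NormedModule)).
    + destruct l as [u v]. unfold plus, scal; simpl.
      unfold prod_plus, prod_scal, plus, scal, mult; simpl. unfold mult; simpl. f_equal; ring.
Qed.

Lemma is_deriveC_fst (f : R -> C) (x : R) (l : C) :
  is_deriveC f x l -> is_derive (fun t => fst (f t)) x (fst l).
Proof.
  intros H.
  apply (filterdiff_comp' (U := R_NormedModule) (V := C_R_NormedModule) (W := R_NormedModule) f fst x _ fst H).
  apply filterdiff_linear, is_linear_fst.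
Qed.

Lemma is_deriveC_snd (f : R -> C) (x : R) (l : C) :
  is_deriveC f x l -> is_derive (fun t => snd (f t)) x (snd l).
Proof.
  intros H.
  apply (filterdiff_comp' (U := R_NormedModule) (V := C_R_NormedModule) (W := R_NormedModule) f snd x _ snd H).
  apply filterdiff_linear, is_linear_snd.
Qed.

Lemma is_deriveC_mult (f g : R -> C) (x : R) (df dg : C) :
  is_deriveC f x df -> is_deriveC g x dg ->
  is_deriveC (fun t => (f t * g t)%C) x (df * g x + f x * dg)%C.
Proof.
  intros Hf Hg.
  assert (F1 := is_deriveC_fst _ _ _ Hf). assert (F2 := is_deriveC_snd _ _ _ Hf).
  assert (G1 := is_deriveC_fst _ _ _ Hg). assert (G2 := is_deriveC_snd _ _ _ Hg).
  apply is_deriveC_pair.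
  - evar_last.
    + apply (is_derive_minus (V := R_NormedModule));
        [exact (is_derive_mult _ _ x _ _ F1 G1 Rmult_comm)
        | exact (is_derive_mult _ _ x _ _ F2 G2 Rmult_comm)].
    + unfold minus, plus, opp, mult; simpl. ring.
  - evar_last.
    + apply (is_derive_plus (V := R_NormedModule));
        [exact (is_derive_mult _ _ x _ _ F1 G2 Rmult_comm)
        | exact (is_derive_mult _ _ x _ _ F2 G1 Rmult_comm)].
    + unfold plus, mult; simpl. ring.
Qed.

Lemma is_deriveC_Cexp (f : R -> C) (x : R) (df : C) :
  is_deriveC f x df -> is_deriveC (fun t => Cexp (f t)) x (df * Cexp (f x))%C.
Proof.
  intros Hf.
  assert (F1 := is_deriveC_fst _ _ _ Hf). assert (F2 := is_deriveC_snd _ _ _ Hf).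
  assert (E1 := is_derive_comp exp (fun t => fst (f t)) x _ _
                  (proj2 (is_derive_Reals _ _ _) (derivable_pt_lim_exp _)) F1).
  assert (E2 := is_derive_comp cos (fun t => snd (f t)) x _ _
                  (proj2 (is_derive_Reals _ _ _) (derivable_pt_lim_cos _)) F2).
  assert (E3 := is_derive_comp sin (fun t => snd (f t)) x _ _
                  (proj2 (is_derive_Reals _ _ _) (derivable_pt_lim_sin _)) F2).
  apply is_deriveC_pair.
  - evar_last; [exact (is_derive_mult _ _ x _ _ E1 E2 Rmult_comm) | ].
    unfold Cexp, Re, Im, plus, mult, scal; simpl. unfold mult; simpl. ring.
  - evar_last; [exact (is_derive_mult _ _ x _ _ E1 E3 Rmult_comm) | ].
    unfold Cexp, Re, Im, plus, mult, scal; simpl. unfold mult; simpl. ring.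
Qed.

Lemma is_deriveC_plus (f g : R -> C) (x : R) (df dg : C) :
  is_deriveC f x df -> is_deriveC g x dg ->
  is_deriveC (fun t => (f t + g t)%C) x (df + dg)%C.
Proof. exact (is_derive_plus (V := C_R_NormedModule) f g x df dg). Qed.

Lemma is_deriveC_const (c : C) (x : R) : is_deriveC (fun _ => c) x (RtoC 0).
Proof. exact (is_derive_const (V := C_R_NormedModule) c x). Qed.

Lemma is_deriveC_RtoC (f : R -> R) (x df : R) :
  is_derive f x df -> is_deriveC (fun t => RtoC (f t)) x (RtoC df).
Proof.
  intros H. apply is_deriveC_pair; simpl; [exact H | exact (is_derive_const 0 x)].
Qed.

Lemma is_deriveC_conj (f : R -> C) (x : R) (df : C) :
  is_deriveC f x df -> is_deriveC (fun t => Cconj (f t)) x (Cconj df).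
Proof.
  intros H. apply is_deriveC_pair; simpl; [now apply is_deriveC_fst | ].
  apply (is_derive_opp (fun t => snd (f t))). now apply is_deriveC_snd.
Qed.

Lemma continuousC_pair (f : R -> C) (x : R) :
  continuous (fun t => fst (f t)) x -> continuous (fun t => snd (f t)) x -> continuousC f x.
Proof.
  intros H1 H2.
  intros P [eps HP].
  assert (B1 := H1 _ (locally_ball (fst (f x)) eps)).
  assert (B2 := H2 _ (locally_ball (snd (f x)) eps)).
  unfold filtermap in B1, B2.
  unfold filtermap. generalize (filter_and _ _ B1 B2). apply filter_imp. intros t [h1 h2].
  apply HP. split; assumption.
Qed.

Lemma continuousC_Cexp (f : R -> C) (x : R) :
  continuous (fun t => fst (f t)) x -> continuous (fun t => snd (f t)) x ->
  continuousC (fun t => Cexp (f t)) x.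
Proof.
  intros H1 H2. apply continuousC_pair; simpl.
  - apply (continuous_mult (fun t => exp (Re (f t))) (fun t => cos (Im (f t)))).
    + apply (continuous_comp (fun t => fst (f t)) exp); [exact H1 | ].
      apply (ex_derive_continuous (V := R_NormedModule) exp). auto_derive. trivial.
    + apply (continuous_comp (fun t => snd (f t)) cos); [exact H2 | apply continuous_cos].
  - apply (continuous_mult (fun t => exp (Re (f t))) (fun t => sin (Im (f t)))).
    + apply (continuous_comp (fun t => fst (f t)) exp); [exact H1 | ].
      apply (ex_derive_continuous (V := R_NormedModule) exp). auto_derive. trivial.
    + apply (continuous_comp (fun t => snd (f t)) sin); [exact H2 | apply continuous_sin].
Qed.

(** * Limits at infinity and improper integrals *)

(** Stated with the modulus, so that it avoids the several uniform structures
    carried by [C]. *)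
Definition tends_to (f : R -> C) (l : C) : Prop :=
  forall eps, 0 < eps -> exists M, forall T, M < T -> Cmod (f T - l)%C < eps.

Lemma tends_to_filterlim (f : R -> C) (l : C) :
  tends_to f l <->
  filterlim f (Rbar_locally p_infty) (locally (T := C_R_NormedModule) l).
Proof.
  split.
  - intros H. apply (proj2 (filterlim_locally_ball_norm (U := C_R_NormedModule) f l)). intros eps.
    destruct (H eps (cond_pos eps)) as [M HM]. exists M. intros T HT.
    unfold ball_norm. rewrite norm_C_R. now apply HM.
  - intros H eps He. assert (H' := proj1 (filterlim_locally_ball_norm (U := C_R_NormedModule) f l) H (mkposreal eps He)).
    destruct H' as [M HM]. exists M. intros T HT. specialize (HM T HT).
    unfold ball_norm in HM. rewrite norm_C_R in HM. exact HM.
Qed.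

Lemma is_RInt_infty_intro (f Phi : R -> C) (a : R) (l : C) :
  (forall b, a <= b -> is_RIntC f a b (Phi b)) -> tends_to Phi l -> is_RInt_infty f a l.
Proof.
  intros H1 H2. apply tends_to_filterlim in H2. intros P HP.
  destruct (H2 P HP) as [M HM].
  apply Filter_prod with (Q := fun x => x = a) (R := fun y => Rmax a M < y).
  - reflexivity.
  - now exists (Rmax a M).
  - intros x y -> Hy. exists (Phi y). assert (h := Rmax_l a M). assert (h' := Rmax_r a M).
    split; [apply H1; simpl; lra | apply HM; lra].
Qed.

Lemma is_RInt_infty_elim (f Phi : R -> C) (a : R) (l : C) :
  (forall b, a <= b -> is_RIntC f a b (Phi b)) -> is_RInt_infty f a l -> tends_to Phi l.
Proof.
  intros H1 H2. apply tends_to_filterlim. intros P HP.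
  destruct (H2 P HP) as [Q S HQ [M HM] HQS]. exists (Rmax a M). intros y Hy.
  assert (h := Rmax_l a M). assert (h' := Rmax_r a M).
  destruct (HQS a y HQ (HM y ltac:(lra))) as [v [Hv1 Hv2]]. simpl in Hv1.
  rewrite <- (is_RInt_unique (V := C_R_CompleteNormedModule) _ _ _ _ (H1 y ltac:(lra))).
  rewrite (is_RInt_unique (V := C_R_CompleteNormedModule) _ _ _ _ Hv1). exact Hv2.
Qed.

Lemma tends_to_plus (f g : R -> C) (l m : C) :
  tends_to f l -> tends_to g m -> tends_to (fun T => (f T + g T)%C) (l + m)%C.
Proof.
  intros Hf Hg eps He.
  destruct (Hf (eps / 2)) as [M HM]; [lra | ]. destruct (Hg (eps / 2)) as [N HN]; [lra | ].
  exists (Rmax M N). intros T HT.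
  assert (h := Rmax_l M N). assert (h' := Rmax_r M N).
  specialize (HM T ltac:(lra)). specialize (HN T ltac:(lra)).
  replace (f T + g T - (l + m))%C with ((f T - l) + (g T - m))%C by ring.
  eapply Rle_lt_trans; [apply Cmod_triangle | lra].
Qed.

Lemma tends_to_scal (c : C) (f : R -> C) (l : C) :
  tends_to f l -> tends_to (fun T => (c * f T)%C) (c * l)%C.
Proof.
  intros Hf eps He. assert (Hc := Cmod_ge_0 c).
  destruct (Hf (eps / (Cmod c + 1))) as [M HM]; [apply Rdiv_lt_0_compat; lra | ].
  exists M. intros T HT. specialize (HM T HT).
  replace (c * f T - c * l)%C with (c * (f T - l))%C by ring. rewrite Cmod_mult.
  apply Rle_lt_trans with (Cmod c * (eps / (Cmod c + 1))).
  - apply Rmult_le_compat_l; lra.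
  - apply Rmult_lt_reg_r with (Cmod c + 1); [lra | ].
    replace (Cmod c * (eps / (Cmod c + 1)) * (Cmod c + 1)) with (Cmod c * eps) by (field; lra). lra.
Qed.

Lemma tends_to_conj (f : R -> C) (l : C) :
  tends_to f l -> tends_to (fun T => Cconj (f T)) (Cconj l).
Proof.
  intros Hf eps He. destruct (Hf eps He) as [M HM]. exists M. intros T HT.
  rewrite <- Cminus_conj, Cmod_conj. now apply HM.
Qed.

Lemma tends_to_const (c : C) : tends_to (fun _ => c) c.
Proof.
  intros eps He. exists 0. intros T _. replace (c - c)%C with (RtoC 0) by ring.
  now rewrite Cmod_0.
Qed.

Lemma tends_to_0_bound (f : R -> C) (g : R -> R) (M : R) :
  (forall T, M < T -> Cmod (f T) <= g T) -> is_lim g p_infty 0 -> tends_to f 0.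
Proof.
  intros H Hg eps He. apply is_lim_spec in Hg. destruct (Hg (mkposreal eps He)) as [N HN].
  exists (Rmax M N). intros T HT. assert (h := Rmax_l M N). assert (h' := Rmax_r M N).
  specialize (H T ltac:(lra)). specialize (HN T ltac:(lra)). simpl in HN.
  rewrite Rminus_0_r in HN. apply Rabs_def2 in HN.
  replace (f T - 0)%C with (f T) by ring. lra.
Qed.

Lemma tends_to_comp (f : R -> C) (g : R -> R) (l : C) :
  tends_to f l -> is_lim g p_infty p_infty -> tends_to (fun T => f (g T)) l.
Proof.
  intros H Hg eps He. destruct (H eps He) as [M HM].
  apply is_lim_spec in Hg. destruct (Hg M) as [N HN]. exists N. intros T HT. apply HM, HN, HT.
Qed.

Lemma is_RIntC_scal (c : C) (f : R -> C) (a b : R) (l : C) :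
  is_RIntC f a b l -> is_RIntC (fun t => (c * f t)%C) a b (c * l)%C.
Proof.
  intros H.
  assert (H1 := is_RInt_fct_extend_fst (U := R_NormedModule) (V := R_NormedModule) f a b l H).
  assert (H2 := is_RInt_fct_extend_snd (U := R_NormedModule) (V := R_NormedModule) f a b l H).
  apply (is_RInt_fct_extend_pair (U := R_NormedModule) (V := R_NormedModule)); simpl.
  - apply (is_RInt_minus (V := R_NormedModule)); now apply (is_RInt_scal (V := R_NormedModule)).
  - apply (is_RInt_plus (V := R_NormedModule)); now apply (is_RInt_scal (V := R_NormedModule)).
Qed.

Lemma is_RIntC_continuous (f : R -> C) (a b : R) :
  (forall t, continuousC f t) -> is_RIntC f a b (RIntC f a b).
Proof.
  intros H. apply (RInt_correct (V := C_R_CompleteNormedModule)).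
  apply (ex_RInt_continuous (V := C_R_CompleteNormedModule)). intros; apply H.
Qed.

Lemma is_RInt_exp_neg (K a b : R) :
  is_RInt (fun t => K * exp (- t)) a b (K * exp (- a) - K * exp (- b)).
Proof.
  replace (K * exp (- a) - K * exp (- b)) with
    (minus ((fun t => - K * exp (- t)) b) ((fun t => - K * exp (- t)) a))
    by (unfold minus, plus, opp; simpl; ring).
  apply (is_RInt_derive (V := R_CompleteNormedModule) (fun t => - K * exp (- t)) (fun t => K * exp (- t))).
  - intros x _. auto_derive; [trivial | ring].
  - intros x _. apply (ex_derive_continuous (fun t => K * exp (- t))). auto_derive. trivial.
Qed.

Lemma RIntC_norm_le (f : R -> C) (g : R -> R) (a b lg : R) (l : C) :
  a <= b -> (forall t, a <= t <= b -> Cmod (f t) <= g t) ->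
  is_RIntC f a b l -> is_RInt g a b lg -> Cmod l <= lg.
Proof.
  intros Hab Hb Hf Hg. rewrite <- norm_C_R.
  apply (norm_RInt_le (V := C_R_NormedModule) f g a b l lg Hab); try assumption.
  intros t Ht. rewrite norm_C_R. now apply Hb.
Qed.

Lemma dominated_K_ge_0 (f : R -> C) (K : R) :
  (forall t, 0 <= t -> Cmod (f t) <= K * exp (- t)) -> 0 <= K.
Proof.
  intros HK. specialize (HK 0 ltac:(lra)). rewrite Ropp_0, exp_0 in HK.
  assert (h := Cmod_ge_0 (f 0)). lra.
Qed.

Lemma dominated_RInt_le (f : R -> C) (K a b : R) :
  (forall t, continuousC f t) -> (forall t, 0 <= t -> Cmod (f t) <= K * exp (- t)) ->
  0 <= a <= b -> Cmod (RIntC f a b) <= K * exp (- a).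
Proof.
  intros Hc HK Hab. apply Rle_trans with (K * exp (- a) - K * exp (- b)).
  - apply RIntC_norm_le with f (fun t => K * exp (- t)) a b.
    + lra.
    + intros t Ht. apply HK. lra.
    + now apply is_RIntC_continuous.
    + apply is_RInt_exp_neg.
  - assert (h := dominated_K_ge_0 f K HK). assert (h' := exp_pos (- b)). nra.
Qed.

(** The partial integrals satisfy the Cauchy criterion, the tail beyond [u]
    being at most [K * exp (- u)]. *)
Lemma dominated_ex (f : R -> C) (K : R) :
  (forall t, continuousC f t) -> (forall t, 0 <= t -> Cmod (f t) <= K * exp (- t)) ->
  exists l, is_RInt_infty f 0 l.
Proof.
  intros Hc HK. assert (HKp := dominated_K_ge_0 f K HK).
  assert (H : exists l : C_R_CompleteNormedModule,
    filterlim (fun b => RIntC f 0 b) (Rbar_locally p_infty) (locally l)).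
  { apply (filterlim_locally_cauchy (U := C_R_CompleteNormedModule)). intros eps.
    set (M := Rmax 0 (K / eps)).
    assert (HM0 : 0 <= M) by apply Rmax_l.
    assert (Hord : forall u v, M < u -> u <= v ->
      Cmod (RIntC f 0 v - RIntC f 0 u)%C < eps).
    { intros u v Hu Huv.
      replace (RIntC f 0 v - RIntC f 0 u)%C with (RIntC f u v).
      2:{ assert (E := RInt_Chasles (V := C_R_CompleteNormedModule) f 0 u v).
          rewrite <- E.
          - change (plus (RIntC f 0 u) (RIntC f u v)) with (RIntC f 0 u + RIntC f u v)%C.
            generalize (RIntC f 0 u) (RIntC f u v). intros p q. change C in p, q.
            change ((q : C) = (p + q - p)%C). ring.
          - eexists. now apply is_RIntC_continuous.
          - eexists. now apply is_RIntC_continuous. }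
      eapply Rle_lt_trans; [apply (dominated_RInt_le f K u v Hc HK); lra | ].
      rewrite exp_Ropp. assert (h := exp_ineq1_le u).
      apply Rmult_lt_reg_r with (exp u); [apply exp_pos | ].
      rewrite Rmult_assoc, Rinv_l, Rmult_1_r by (assert (h' := exp_pos u); lra).
      assert (h2 : K / eps < exp u) by (assert (h3 := Rmax_r 0 (K / eps)); fold M in h3; lra).
      apply Rmult_lt_compat_l with (r := eps) in h2; [ | apply cond_pos].
      replace (eps * (K / eps)) with K in h2; [exact h2 | ].
      field. assert (h4 := cond_pos eps). lra. }
    exists (fun b => M < b). split; [now exists M | ].
    intros u v Hu Hv. apply (norm_compat1 (V := C_R_NormedModule)).
    rewrite norm_C_R.
    destruct (Rle_lt_dec u v) as [h | h].
    - now apply Hord.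
    - rewrite <- Cmod_opp.
      change (minus (RIntC f 0 v) (RIntC f 0 u)) with (RIntC f 0 v - RIntC f 0 u)%C.
      replace (- (RIntC f 0 v - RIntC f 0 u))%C with (RIntC f 0 u - RIntC f 0 v)%C by ring.
      apply Hord; lra. }
  destruct H as [l Hl]. exists l. apply is_RInt_infty_intro with (fun b => RIntC f 0 b).
  - intros b _. now apply is_RIntC_continuous.
  - now apply tends_to_filterlim.
Qed.

Lemma dominated_le (f : R -> C) (K : R) (l : C) :
  (forall t, continuousC f t) -> (forall t, 0 <= t -> Cmod (f t) <= K * exp (- t)) ->
  is_RInt_infty f 0 l -> Cmod l <= K.
Proof.
  intros Hc HK Hl.
  assert (H := is_RInt_infty_elim f (fun b => RIntC f 0 b) 0 l
                 (fun b _ => is_RIntC_continuous f 0 b Hc) Hl).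
  apply Rnot_lt_le. intros Hlt. destruct (H (Cmod l - K) ltac:(lra)) as [M HM].
  set (T := Rmax 0 M + 1). assert (h := Rmax_l 0 M). assert (h' := Rmax_r 0 M).
  specialize (HM T ltac:(unfold T; lra)).
  assert (E := dominated_RInt_le f K 0 T Hc HK ltac:(unfold T; lra)).
  rewrite Ropp_0, exp_0, Rmult_1_r in E.
  assert (Tr := Cmod_triangle (RIntC f 0 T) (- (RIntC f 0 T - l))).
  replace (RIntC f 0 T + - (RIntC f 0 T - l))%C with l in Tr by ring.
  rewrite Cmod_opp in Tr. lra.
Qed.

(** * Rotation of the path of integration *)

Lemma continuity_2d_slice (W : R -> R -> R) (th r : R) :
  continuity_2d_pt W th r -> continuous (fun r => W th r) r.
Proof.
  intros H. apply continuity_2d_pt_filterlim in H.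
  apply (filterlim_comp _ _ _ (fun r : R => (th, r)) (fun z : R * R => W (fst z) (snd z)) _ (locally (th, r))).
  - apply filterlim_locally. intros eps. exists eps. intros v Hv. split; [apply ball_center | exact Hv].
  - exact H.
Qed.

(** Differentiation under the integral sign and [dU/dth = W = dV/dr] give the
    derivative [V th T - V th 0 = V th T] of the integral of [U th]; the bound is
    then the mean value inequality in [th]. *)
Lemma homotopy_bound (U V W : R -> R -> R) (T th1 M : R) :
  0 <= th1 ->
  (forall th r, is_derive (fun th => U th r) th (W th r)) ->
  (forall th r, is_derive (fun r => V th r) r (W th r)) ->
  (forall th r, continuity_2d_pt W th r) ->
  (forall th r, continuous (fun r => U th r) r) ->
  (forall th, V th 0 = 0) ->
  (forall th, 0 <= th <= th1 -> Rabs (V th T) <= M) ->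
  Rabs (RInt (U th1) 0 T - RInt (U 0) 0 T) <= M * th1.
Proof.
  intros Hth HU HV HW HcU HV0 HM.
  assert (D : forall th, is_derive (fun th => RInt (fun r => U th r) 0 T) th (V th T)).
  { intros th.
    replace (V th T) with (RInt (fun r => Derive (fun th => U th r) th) 0 T).
    - apply (is_derive_RInt_param (fun th r => U th r) 0 T th).
      + exists (mkposreal 1 Rlt_0_1). intros th' _ r _. eexists. apply HU.
      + intros r _. apply continuity_2d_pt_ext with W; [ | apply HW].
        intros u v. symmetry. apply is_derive_unique. apply HU.
      + exists (mkposreal 1 Rlt_0_1). intros th' _.
        apply (ex_RInt_continuous (V := R_CompleteNormedModule)). intros r _. apply HcU.
    - rewrite (RInt_ext (V := R_CompleteNormedModule) _ (fun r => W th r)).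
      2:{ intros r _. apply is_derive_unique. apply HU. }
      replace (V th T) with (minus (V th T) (V th 0)).
      2:{ rewrite HV0. unfold minus, plus, opp; simpl. ring. }
      apply is_RInt_unique.
      apply (is_RInt_derive (V := R_CompleteNormedModule) (fun r => V th r) (fun r => W th r)).
      + intros r _. apply HV.
      + intros r _. apply continuity_2d_slice, HW. }
  destruct (MVT_gen (fun th => RInt (fun r => U th r) 0 T) 0 th1 (fun th => V th T)) as [c [Hc E]].
  - intros th _. apply D.
  - intros th _. apply continuity_pt_filterlim.
    apply (ex_derive_continuous (fun th => RInt (fun r => U th r) 0 T)). eexists. apply D.
  - assert (E' : RInt (U th1) 0 T - RInt (U 0) 0 T = V c T * (th1 - 0)) by exact E.
    rewrite E', Rabs_mult, Rminus_0_r, (Rabs_pos_eq th1) by exact Hth.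
    apply Rmult_le_compat_r; [exact Hth | ]. apply HM.
    rewrite Rmin_left, Rmax_right in Hc by exact Hth. exact Hc.
Qed.

(** Real and imaginary part of
    [i r^a e^(i a th) - i z r e^(i th) + i th], the logarithm of [e^(i th)]
    times the integrand at the point [r e^(i th)], where [z = x + i y]. *)
Definition rayX (a x y th r : R) : R :=
  - rpow r a * sin (a * th) + r * (x * sin th + y * cos th).
Definition rayY (a x y th r : R) : R :=
  rpow r a * cos (a * th) - r * (x * cos th - y * sin th) + th.

Definition rayXth (a x y th r : R) : R :=
  - rpow r a * (a * cos (a * th)) + r * (x * cos th - y * sin th).
Definition rayYth (a x y th r : R) : R :=
  - rpow r a * (a * sin (a * th)) + r * (x * sin th + y * cos th) + 1.

(** The phase [phi] treats the real part ([phi = 0]) and the imaginary part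
    ([phi = - PI / 2]) together. *)
Definition rayU (a x y phi th r : R) : R :=
  exp (rayX a x y th r) * cos (rayY a x y th r + phi).
Definition rayV (a x y phi th r : R) : R :=
  - r * (exp (rayX a x y th r) * sin (rayY a x y th r + phi)).
Definition rayW (a x y phi th r : R) : R :=
  exp (rayX a x y th r) *
  (rayXth a x y th r * cos (rayY a x y th r + phi)
   - rayYth a x y th r * sin (rayY a x y th r + phi)).

Lemma rayU_derive (a x y phi th r : R) :
  is_derive (fun th => rayU a x y phi th r) th (rayW a x y phi th r).
Proof.
  unfold rayU, rayW, rayX, rayY, rayXth, rayYth. auto_derive; [trivial | ]. unfold Rminus. ring.
Qed.

Lemma rayV_derive (a x y phi th r : R) : 1 < a ->
  is_derive (fun r => rayV a x y phi th r) r (rayW a x y phi th r).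
Proof.
  intros Ha. assert (D := is_derive_rpow r a Ha).
  unfold rayV, rayW, rayX, rayY, rayXth, rayYth. auto_derive.
  - repeat split; eexists; exact D.
  - replace (Derive (fun u : R => rpow u a) r) with (a * rpow r (a - 1))
      by (symmetry; apply is_derive_unique, D).
    rewrite (rpow_split r a Ha). unfold Rminus. ring.
Qed.

Lemma continuity_2d_comp (f : R -> R) (g : R -> R -> R) (x y : R) :
  (forall u, continuous f u) -> continuity_2d_pt g x y ->
  continuity_2d_pt (fun u v => f (g u v)) x y.
Proof.
  intros Hf Hg. apply continuity_2d_pt_filterlim in Hg. apply continuity_2d_pt_filterlim.
  exact (filterlim_comp _ _ _ _ f _ _ _ Hg (Hf (g x y))).
Qed.

Lemma continuous_exp_R (u : R) : continuous exp u.
Proof. apply (ex_derive_continuous (V := R_NormedModule) exp). auto_derive. trivial. Qed.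

Ltac cont2d :=
  match goal with
  | |- continuity_2d_pt (fun u v => _ + _) _ _ => apply continuity_2d_pt_plus; cont2d
  | |- continuity_2d_pt (fun u v => _ - _) _ _ => apply continuity_2d_pt_minus; cont2d
  | |- continuity_2d_pt (fun u v => _ * _) _ _ => apply continuity_2d_pt_mult; cont2d
  | |- continuity_2d_pt (fun u v => - _) _ _ => apply continuity_2d_pt_opp; cont2d
  | |- continuity_2d_pt (fun u v => u) _ _ => apply continuity_2d_pt_id1
  | |- continuity_2d_pt (fun u v => v) _ _ => apply continuity_2d_pt_id2
  | |- continuity_2d_pt (fun u v => ?c) _ _ => apply continuity_2d_pt_const
  | |- continuity_2d_pt (fun u v => sin (@?g u v)) _ _ =>
      apply (continuity_2d_comp sin g); [apply continuous_sin | cont2d]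
  | |- continuity_2d_pt (fun u v => cos (@?g u v)) _ _ =>
      apply (continuity_2d_comp cos g); [apply continuous_cos | cont2d]
  | |- continuity_2d_pt (fun u v => exp (@?g u v)) _ _ =>
      apply (continuity_2d_comp exp g); [apply continuous_exp_R | cont2d]
  | |- continuity_2d_pt (fun u v => rpow (@?g u v) ?a) _ _ =>
      apply (continuity_2d_comp (fun w => rpow w a) g);
        [intro; apply continuous_rpow; lra | cont2d]
  end.

Lemma rayW_continuous (a x y phi th r : R) : 1 < a ->
  continuity_2d_pt (rayW a x y phi) th r.
Proof.
  intros Ha. unfold rayW, rayX, rayY, rayXth, rayYth. cont2d.
Qed.

Lemma rayU_continuous (a x y phi th r : R) : 1 < a ->
  continuous (fun r => rayU a x y phi th r) r.
Proof.
  intros Ha. apply (continuity_2d_slice (rayU a x y phi)).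
  unfold rayU, rayX, rayY. cont2d.
Qed.

(** On the sector [0 <= a th <= PI / 2] one has [sin (a th) >= sin th], so for
    large [r] the term [r^a sin (a th)] absorbs [r x sin th] and only the
    decaying factor [exp (r y cos th)] is left. *)
Lemma rayX_le (a x y T th : R) : 1 < a -> y < 0 -> 0 <= T -> Rabs x * T <= rpow T a ->
  0 <= th <= PI / (2 * a) ->
  rayX a x y th T <= T * (y * cos (PI / (2 * a))).
Proof.
  intros Ha Hy HT Hx Hth.
  assert (HPI := PI_RGT_0).
  assert (H1 : a * (PI / (2 * a)) = PI / 2) by (field; lra).
  assert (H1' : PI / (2 * a) <= PI / 2).
  { rewrite <- H1. assert (0 < PI / (2 * a)) by (apply Rdiv_lt_0_compat; lra). nra. }
  assert (H2 : a * th <= PI / 2) by (rewrite <- H1; apply Rmult_le_compat_l; lra).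
  assert (Hat : th <= a * th) by nra.
  assert (S1 : sin th <= sin (a * th)) by (apply sin_incr_1; lra).
  assert (S0 : 0 <= sin th) by (apply sin_ge_0; lra).
  assert (C1 : cos (PI / (2 * a)) <= cos th) by (apply cos_decr_1; lra).
  assert (E1 : T * (x * sin th) <= rpow T a * sin (a * th)).
  { apply Rle_trans with (Rabs x * T * sin th).
    - replace (T * (x * sin th)) with (x * (T * sin th)) by ring.
      rewrite Rmult_assoc. apply Rmult_le_compat_r; [ | apply Rle_abs].
      apply Rmult_le_pos; assumption.
    - apply Rmult_le_compat; try assumption. apply Rmult_le_pos; [apply Rabs_pos | assumption]. }
  assert (E2 : T * (y * cos th) <= T * (y * cos (PI / (2 * a)))).
  { apply Rmult_le_compat_l; [assumption | ]. nra. }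
  unfold rayX. nra.
Qed.

Lemma rayV_bound (a x y phi T th : R) : 1 < a -> y < 0 -> 0 <= T -> Rabs x * T <= rpow T a ->
  0 <= th <= PI / (2 * a) ->
  Rabs (rayV a x y phi th T) <= T * exp (T * (y * cos (PI / (2 * a)))).
Proof.
  intros Ha Hy HT Hx Hth. unfold rayV.
  rewrite !Rabs_mult, Rabs_Ropp, (Rabs_pos_eq T) by exact HT.
  apply Rmult_le_compat_l; [exact HT | ].
  rewrite (Rabs_pos_eq (exp _)) by (left; apply exp_pos).
  assert (E := rayX_le a x y T th Ha Hy HT Hx Hth).
  assert (E' : exp (rayX a x y th T) <= exp (T * (y * cos (PI / (2 * a))))).
  { destruct E as [E | E]; [left; now apply exp_increasing | right; now rewrite E]. }
  rewrite <- (Rmult_1_r (exp (T * _))).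
  apply Rmult_le_compat; [left; apply exp_pos | apply Rabs_pos | exact E' | ].
  apply Rabs_le. apply SIN_bound.
Qed.

(** The right-hand side tends to 0 as [T] grows, since [y < 0] and the cosine
    of [PI / (2 a)] is positive. *)
Lemma ray_rotation (a x y phi T : R) : 1 < a -> y < 0 -> 0 <= T -> Rabs x * T <= rpow T a ->
  Rabs (RInt (rayU a x y phi (PI / (2 * a))) 0 T - RInt (rayU a x y phi 0) 0 T)
  <= T * exp (T * (y * cos (PI / (2 * a)))) * (PI / (2 * a)).
Proof.
  intros Ha Hy HT Hx.
  apply homotopy_bound with (rayV a x y phi) (rayW a x y phi).
  - left. apply Rdiv_lt_0_compat; [apply PI_RGT_0 | lra].
  - intros; apply rayU_derive.
  - intros; now apply rayV_derive.
  - intros; now apply rayW_continuous.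
  - intros; now apply rayU_continuous.
  - intros th. unfold rayV. ring.
  - intros th Hth. now apply rayV_bound.
Qed.

Lemma is_lim_T_exp (m c : R) : 0 < m -> is_lim (fun T => T * exp (T * - m) * c) p_infty 0.
Proof.
  intros Hm. apply is_lim_spec. intros eps.
  exists (Rmax 1 (4 * (Rabs c + 1) / (m * m * eps))). intros T HT.
  assert (h1 := Rmax_l 1 (4 * (Rabs c + 1) / (m * m * eps))).
  assert (h2 := Rmax_r 1 (4 * (Rabs c + 1) / (m * m * eps))).
  assert (He := cond_pos eps). assert (Hc := Rabs_pos c).
  set (N := 4 * (Rabs c + 1) / (m * m * eps)) in *.
  assert (EN : N * (m * m * eps) = 4 * (Rabs c + 1)) by (unfold N; field; split; lra).
  rewrite Rminus_0_r, !Rabs_mult, (Rabs_pos_eq T) by lra.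
  rewrite (Rabs_pos_eq (exp _)) by (left; apply exp_pos).
  (* Quadratic growth is enough to beat the factor [T]:
     [exp u = exp (u / 2) ^ 2 >= (u / 2) ^ 2]. *)
  assert (E : (T * m / 2) * (T * m / 2) <= exp (T * m)).
  { replace (T * m) with (T * m / 2 + T * m / 2) at 3 by field. rewrite exp_plus.
    assert (h := exp_ineq1_le (T * m / 2)). assert (0 < T * m) by nra.
    apply Rmult_le_compat; lra. }
  replace (T * - m) with (- (T * m)) by ring. rewrite exp_Ropp.
  assert (Hp := exp_pos (T * m)).
  apply Rmult_lt_reg_r with (exp (T * m)); [exact Hp | ].
  replace (T * / exp (T * m) * Rabs c * exp (T * m)) with (T * Rabs c) by (field; lra).
  apply Rlt_le_trans with (eps * ((T * m / 2) * (T * m / 2))); [ | apply Rmult_le_compat_l; lra].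
  assert (0 < m * m * eps) by (apply Rmult_lt_0_compat; [nra | lra]).
  assert (N * (m * m * eps) < T * (m * m * eps)) by (apply Rmult_lt_compat_r; lra).
  nra.
Qed.

(** * Taylor estimates *)

Lemma exp_le (x y : R) : x <= y -> exp x <= exp y.
Proof. intros [H | ->]; [left; now apply exp_increasing | apply Rle_refl]. Qed.

Lemma increment_bound (f df : R -> R) (x M : R) :
  (forall t, is_derive f t (df t)) ->
  (forall t, Rabs t <= Rabs x -> Rabs (df t) <= M) ->
  Rabs (f x - f 0) <= M * Rabs x.
Proof.
  intros Hf HM. destruct (MVT_cor4 f df 0 (Rabs x)) with (b := x) as [c [E Hc]].
  - intros; apply Hf.
  - rewrite Rminus_0_r. apply Rle_refl.
  - rewrite !Rminus_0_r in *. rewrite E, Rabs_mult.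
    apply Rmult_le_compat_r; [apply Rabs_pos | now apply HM].
Qed.

Lemma exp_sub_1_bound (p : R) : Rabs (exp p - 1) <= exp (Rabs p) * Rabs p.
Proof.
  rewrite <- exp_0. apply (increment_bound exp exp).
  - intros t. auto_derive; [trivial | ring].
  - intros t Ht. rewrite Rabs_pos_eq by (left; apply exp_pos). apply exp_le.
    eapply Rle_trans; [apply Rle_abs | exact Ht].
Qed.

Lemma exp_taylor2_bound (p : R) : Rabs (exp p - 1 - p) <= exp (Rabs p) * Rabs p * Rabs p.
Proof.
  replace (exp p - 1 - p) with ((exp p - p) - (exp 0 - 0)) by (rewrite exp_0; ring).
  apply (increment_bound (fun p => exp p - p) (fun p => exp p - 1)).
  - intros t. auto_derive; [trivial | ring].
  - intros t Ht. eapply Rle_trans; [apply exp_sub_1_bound | ].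
    apply Rmult_le_compat; [left; apply exp_pos | apply Rabs_pos | now apply exp_le | exact Ht].
Qed.

Lemma cos_sub_1_bound (q : R) : Rabs (cos q - 1) <= Rabs q.
Proof.
  rewrite <- cos_0, <- (Rmult_1_l (Rabs q)). apply (increment_bound cos (fun t => - sin t)).
  - intros t. auto_derive; [trivial | ring].
  - intros t _. rewrite Rabs_Ropp. apply Rabs_le, SIN_bound.
Qed.

Lemma cos_taylor2_bound (q : R) : Rabs (cos q - 1) <= Rabs q * Rabs q.
Proof.
  rewrite <- cos_0. apply (increment_bound cos (fun t => - sin t)).
  - intros t. auto_derive; [trivial | ring].
  - intros t Ht. rewrite Rabs_Ropp.
    replace (sin t) with (sin t - sin 0) by (rewrite sin_0; ring).
    apply Rle_trans with (1 * Rabs t); [ | lra]. apply (increment_bound sin cos).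
    + intros s. auto_derive; [trivial | ring].
    + intros s _. apply Rabs_le, COS_bound.
Qed.

Lemma sin_taylor2_bound (q : R) : Rabs (sin q - q) <= Rabs q * Rabs q.
Proof.
  replace (sin q - q) with ((sin q - q) - (sin 0 - 0)) by (rewrite sin_0; ring).
  apply (increment_bound (fun t => sin t - t) (fun t => cos t - 1)).
  - intros t. auto_derive; [trivial | ring].
  - intros t Ht. eapply Rle_trans; [apply cos_sub_1_bound | exact Ht].
Qed.

(** The constant 5 is not sharp: it collects the errors of the real and of the
    imaginary part, each reduced to real Taylor estimates. *)
Lemma Cexp_taylor2_bound (w : C) :
  Cmod (Cexp w - 1 - w)%C <= 5 * (Cmod w * Cmod w) * exp (Cmod w).
Proof.
  destruct w as [p q].
  assert (Hp := Rabs_fst_le_Cmod (p, q)). assert (Hq := Rabs_snd_le_Cmod (p, q)). simpl in Hp, Hq.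
  set (N := Cmod (p, q)) in *. assert (HN : 0 <= N) by apply Cmod_ge_0.
  assert (HP := Rabs_pos p). assert (HQ := Rabs_pos q).
  assert (Epos := exp_pos N).
  assert (Eexp : exp (Rabs p) <= exp N) by now apply exp_le.
  assert (Ep : exp p <= exp N) by (apply exp_le; eapply Rle_trans; [apply Rle_abs | exact Hp]).
  assert (E1 : 1 <= exp N) by (rewrite <- exp_0; now apply exp_le).
  assert (B1 := exp_taylor2_bound p). assert (B2 := exp_sub_1_bound p).
  assert (B3 := cos_taylor2_bound q). assert (B4 := sin_taylor2_bound q).
  assert (Pp : exp p > 0) by apply exp_pos.
  assert (PP : exp (Rabs p) > 0) by apply exp_pos.
  eapply Rle_trans; [apply Cmod_le_abs | ].
  unfold Cexp, Re, Im; simpl.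
  assert (M2 : forall u v, 0 <= u <= N -> 0 <= v <= N -> u * v <= N * N).
  { intros u v Hu Hv. apply Rmult_le_compat; lra. }
  assert (Hpp := M2 _ _ (conj HP Hp) (conj HP Hp)).
  assert (Hqq := M2 _ _ (conj HQ Hq) (conj HQ Hq)).
  assert (Hpq := M2 _ _ (conj HP Hp) (conj HQ Hq)).
  assert (A1 : Rabs (exp p * cos q + - (1) + - p) <= 2 * (N * N) * exp N).
  { replace (exp p * cos q + - (1) + - p) with ((exp p - 1 - p) + exp p * (cos q - 1)) by ring.
    eapply Rle_trans; [apply Rabs_triang | ]. rewrite Rabs_mult, (Rabs_pos_eq (exp p)) by lra.
    assert (exp (Rabs p) * Rabs p * Rabs p <= exp N * (N * N)).
    { rewrite Rmult_assoc. apply Rmult_le_compat; try lra. nra. }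
    assert (exp p * Rabs (cos q - 1) <= exp N * (N * N)).
    { apply Rmult_le_compat; try lra. apply Rabs_pos. }
    lra. }
  assert (A2 : Rabs (exp p * sin q + - 0 + - q) <= 3 * (N * N) * exp N).
  { replace (exp p * sin q + - 0 + - q) with ((exp p - 1) * q + exp p * (sin q - q)) by ring.
    eapply Rle_trans; [apply Rabs_triang | ]. rewrite !Rabs_mult, (Rabs_pos_eq (exp p)) by lra.
    assert (Rabs (exp p - 1) * Rabs q <= exp N * (N * N)).
    { apply Rle_trans with (exp (Rabs p) * Rabs p * Rabs q).
      - apply Rmult_le_compat_r; lra.
      - rewrite Rmult_assoc. apply Rmult_le_compat; try lra. nra. }
    assert (exp p * Rabs (sin q - q) <= exp N * (N * N)).
    { apply Rmult_le_compat; try lra. apply Rabs_pos. }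
    assert (0 <= exp N * (N * N)) by (apply Rmult_le_pos; [lra | nra]). lra. }
  lra.
Qed.

(** * Complex differentiability in terms of the modulus *)

Notation is_deriveCC := (is_derive (K := C_AbsRing) (V := C_NormedModule)).

Lemma is_deriveCC_intro (f : C -> C) (z l : C) :
  (forall eps, 0 < eps -> exists d, 0 < d /\ forall w, Cmod (w - z)%C < d ->
     Cmod (f w - f z - (w - z) * l)%C <= eps * Cmod (w - z)%C) ->
  is_deriveCC f z l.
Proof.
  intros H. split; [apply (is_linear_scal_l (V := C_NormedModule) l) | ].
  intros x Hx. apply (is_filter_lim_locally_unique (V := AbsRing_NormedModule C_AbsRing)) in Hx.
  subst x. intros eps. destruct (H eps (cond_pos eps)) as [d [Hd Hw]].
  exists (mkposreal d Hd). intros w Hwz. exact (Hw w Hwz).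
Qed.

Lemma is_deriveCC_elim (f : C -> C) (z l : C) :
  is_deriveCC f z l ->
  forall eps, 0 < eps -> exists d, 0 < d /\ forall w, Cmod (w - z)%C < d ->
     Cmod (f w - f z - (w - z) * l)%C <= eps * Cmod (w - z)%C.
Proof.
  intros [_ H] eps He.
  destruct (H z (fun P HP => HP) (mkposreal eps He)) as [d Hd].
  exists d. split; [apply cond_pos | ]. intros w Hw. exact (Hd w Hw).
Qed.

(** * The integral along the rotated ray *)

Lemma continuousC_Cexp_affine (p : R -> R) (c0 c d : C) (t : R) :
  continuous p t -> continuousC (fun t => Cexp (c0 * RtoC (p t) + c * RtoC t + d)%C) t.
Proof.
  intros Hp.
  assert (H : forall u v w : R, continuous (fun t => u * p t + v * t + w) t).
  { intros u v w.
    apply (continuous_plus (fun t => u * p t + v * t) (fun _ => w)); [ | apply continuous_const].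
    apply (continuous_plus (fun t => u * p t) (fun t => v * t)).
    - exact (continuous_scal_r u p t Hp).
    - exact (continuous_scal_r v (fun t => t) t (continuous_id t)). }
  apply continuousC_Cexp.
  - apply continuous_ext with (fun t => fst c0 * p t + fst c * t + fst d); [ | apply H].
    intros s. simpl. ring.
  - apply continuous_ext with (fun t => snd c0 * p t + snd c * t + snd d); [ | apply H].
    intros s. simpl. ring.
Qed.

Lemma continuousC_mult_lin (c : C) (f : R -> C) (t : R) :
  continuousC f t -> continuousC (fun t => (c * RtoC t * f t)%C) t.
Proof.
  intros H.
  assert (H1 : continuous (fun t => fst (f t)) t).
  { apply (continuous_comp (V := C_R_NormedModule) f fst t H).
    destruct (f t) as [u v]. exact (continuous_fst u v). }
  assert (H2 : continuous (fun t => snd (f t)) t).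
  { apply (continuous_comp (V := C_R_NormedModule) f snd t H).
    destruct (f t) as [u v]. exact (continuous_snd u v). }
  assert (L : forall (u : R) (g : R -> R), continuous g t -> continuous (fun t => u * t * g t) t).
  { intros u g Hg. apply (continuous_mult (fun t => u * t) g); [ | exact Hg].
    exact (continuous_scal_r u (fun t => t) t (continuous_id t)). }
  apply continuousC_pair.
  - apply continuous_ext with (fun t => fst c * t * fst (f t) - snd c * t * snd (f t)).
    + intros s; simpl; ring.
    + apply (continuous_minus (fun t => fst c * t * fst (f t)) (fun t => snd c * t * snd (f t))); now apply L.
  - apply continuous_ext with (fun t => fst c * t * snd (f t) + snd c * t * fst (f t)).
    + intros s; simpl; ring.
    + apply (continuous_plus (fun t => fst c * t * snd (f t)) (fun t => snd c * t * fst (f t))); now apply L.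
Qed.

Lemma is_RInt_infty_scal (c : C) (f : R -> C) (a : R) (l : C) :
  (forall t, continuousC f t) -> is_RInt_infty f a l ->
  is_RInt_infty (fun t => (c * f t)%C) a (c * l)%C.
Proof.
  intros Hc H. apply is_RInt_infty_intro with (fun b => (c * RIntC f a b)%C).
  - intros b _. now apply is_RIntC_scal, is_RIntC_continuous.
  - apply tends_to_scal. apply is_RInt_infty_elim with f a; [ | exact H].
    intros b _. now apply is_RIntC_continuous.
Qed.

Lemma is_RInt_infty_minus (f g : R -> C) (a : R) (l m : C) :
  is_RInt_infty f a l -> is_RInt_infty g a m ->
  is_RInt_infty (fun t => (f t - g t)%C) a (l - m)%C.
Proof. exact (is_RInt_gen_minus (V := C_R_NormedModule) f g l m). Qed.

Definition ray_angle (a : R) : R := PI / (2 * a).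
Definition ray_dir (a : R) : C := (cos (ray_angle a), sin (ray_angle a)).

(** With [w = r e^(i th)] and [a th = PI / 2], the term [i w^a] is [- r^a]; the
    last summand [i th] accounts for the factor [e^(i th)] of [dw]. *)
Definition ray_integrand (a : R) (z : C) (r : R) : C :=
  Cexp ((- (1)) * RtoC (rpow r a) + (- Ci * z * ray_dir a) * RtoC r + Ci * RtoC (ray_angle a))%C.

Definition F_ray (a : R) (z : C) : C :=
  RInt_gen (V := C_R_CompleteNormedModule) (ray_integrand a z) (at_point 0) (Rbar_locally p_infty).

Lemma Cmod_ray_dir (a : R) : Cmod (ray_dir a) = 1.
Proof.
  unfold Cmod, ray_dir; simpl. rewrite !Rmult_1_r.
  assert (h := sin2_cos2 (ray_angle a)). unfold Rsqr in h. rewrite Rplus_comm, h. apply sqrt_1.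
Qed.

Lemma continuous_ray_integrand (a : R) (z : C) (t : R) : 1 < a ->
  continuousC (ray_integrand a z) t.
Proof.
  intros Ha. apply (continuousC_Cexp_affine (fun r => rpow r a)). apply continuous_rpow. lra.
Qed.

Lemma Cmod_ray_integrand (a : R) (z : C) (r : R) : 0 <= r ->
  Cmod (ray_integrand a z r) <= exp (- rpow r a + Cmod z * r).
Proof.
  intros Hr. unfold ray_integrand. rewrite Cmod_Cexp. apply exp_le.
  set (c := (- Ci * z * ray_dir a)%C).
  replace (Re _) with (- rpow r a + Re c * r).
  - apply Rplus_le_compat_l, Rmult_le_compat_r; [exact Hr | ].
    eapply Rle_trans; [apply Rle_abs | ]. eapply Rle_trans; [apply re_le_Cmod | ].
    unfold c. rewrite !Cmod_mult, Cmod_opp, Cmod_Ci, Cmod_ray_dir. lra.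
  - unfold Re; simpl. ring.
Qed.

(** This reduces the dependence on [z] to a single exponential factor, so that
    its Taylor expansion controls the difference quotients. *)
Lemma ray_integrand_shift (a : R) (z w : C) (r : R) :
  ray_integrand a w r =
  (ray_integrand a z r * Cexp ((- Ci * ray_dir a * RtoC r) * (w - z)))%C.
Proof.
  unfold ray_integrand. rewrite <- Cexp_plus. f_equal. ring.
Qed.

Lemma F_ray_correct (a : R) (z : C) : 1 < a -> is_RInt_infty (ray_integrand a z) 0 (F_ray a z).
Proof.
  intros Ha. destruct (exp_rpow_dominated a (Cmod z) Ha) as [K [HK H]].
  destruct (dominated_ex (ray_integrand a z) K) as [l Hl].
  - intros t. now apply continuous_ray_integrand.
  - intros t Ht. eapply Rle_trans; [now apply Cmod_ray_integrand | now apply H].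
  - replace (F_ray a z) with l; [exact Hl | ].
    symmetry. exact (is_RInt_gen_unique (V := C_R_CompleteNormedModule) _ _ Hl).
Qed.

(** The candidate derivative is the integral [D] of the derivative [f] of the
    integrand. The remainder of order two is at most
    [5 |w - z|^2 r^2 exp (|w - z| r)] times the integrand, hence dominated by a
    multiple of [|w - z|^2 exp (- r)]. *)
Lemma F_ray_entire (a : R) : 1 < a -> entire (F_ray a).
Proof.
  intros Ha z _.
  (* Three spare factors [exp r] absorb [r], a second [r], and
     [exp (|w - z| r)] for [|w - z| < 1]. *)
  destruct (exp_rpow_dominated a (Cmod z + 3) Ha) as [K [HK H]].
  set (c := (- Ci * ray_dir a)%C).
  assert (Hc : Cmod c = 1).
  { unfold c. rewrite Cmod_mult, Cmod_opp, Cmod_Ci, Cmod_ray_dir. ring. }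
  set (f := fun r => (c * RtoC r * ray_integrand a z r)%C).
  assert (Cf : forall t, continuousC f t).
  { intros t. apply continuousC_mult_lin. now apply continuous_ray_integrand. }
  assert (Hexp : forall r, 0 <= r -> forall k : R, k <= 3 ->
            exp (- rpow r a + Cmod z * r) * exp (k * r) <= K * exp (- r)).
  { intros r Hr k Hk. eapply Rle_trans; [ | now apply H]. rewrite <- exp_plus. apply exp_le. nra. }
  destruct (dominated_ex f K) as [D HD]; [exact Cf | | ].
  { intros r Hr. unfold f. rewrite !Cmod_mult, Hc, Cmod_R, (Rabs_pos_eq r), Rmult_1_l by exact Hr.
    eapply Rle_trans; [ | apply (Hexp r Hr 1); lra].
    rewrite Rmult_comm. apply Rmult_le_compat.
    - apply Cmod_ge_0.
    - exact Hr.
    - now apply Cmod_ray_integrand.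
    - assert (h := exp_ineq1_le (1 * r)). lra. }
  exists D. apply is_deriveCC_intro. intros eps He.
  exists (Rmin 1 (eps / (5 * K))). split.
  { apply Rmin_pos; [lra | ]. apply Rdiv_lt_0_compat; lra. }
  intros w Hw. set (h := (w - z)%C) in *.
  assert (Hh1 : Cmod h < 1) by (eapply Rlt_le_trans; [exact Hw | apply Rmin_l]).
  assert (Hh2 : Cmod h < eps / (5 * K)) by (eapply Rlt_le_trans; [exact Hw | apply Rmin_r]).
  assert (Hh0 := Cmod_ge_0 h).
  set (g := fun r => (ray_integrand a w r - ray_integrand a z r - h * f r)%C).
  assert (Hg : is_RInt_infty g 0 (F_ray a w - F_ray a z - h * D)%C).
  { apply is_RInt_infty_minus.
    - apply is_RInt_infty_minus; now apply F_ray_correct.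
    - now apply is_RInt_infty_scal. }
  assert (Eg : forall r, g r = (ray_integrand a z r * (Cexp (c * RtoC r * h) - 1 - c * RtoC r * h))%C).
  { intros r. unfold g, f. rewrite (ray_integrand_shift a z w r). fold h c. ring. }
  apply Rle_trans with (5 * (Cmod h * Cmod h) * K).
  - apply (dominated_le g).
    + intros t. apply (continuous_minus (V := C_R_NormedModule)).
      * apply (continuous_minus (V := C_R_NormedModule)); now apply continuous_ray_integrand.
      * apply (continuous_ext (T := R_UniformSpace) (U := C_R_NormedModule)
                 (fun r => ((h * c) * RtoC r * ray_integrand a z r)%C)).
        { intros r. unfold f. change (((h * c) * RtoC r * ray_integrand a z r)%C
            = (h * (c * RtoC r * ray_integrand a z r))%C). ring. }
        apply continuousC_mult_lin. now apply continuous_ray_integrand.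
    + intros r Hr. rewrite Eg, Cmod_mult.
      assert (Hn : Cmod (c * RtoC r * h) = r * Cmod h).
      { rewrite !Cmod_mult, Hc, Cmod_R, (Rabs_pos_eq r) by exact Hr. ring. }
      assert (B := Cexp_taylor2_bound (c * RtoC r * h)%C). rewrite Hn in B.
      assert (B' : Cmod (Cexp (c * RtoC r * h) - 1 - c * RtoC r * h)%C
                   <= 5 * (Cmod h * Cmod h) * exp (3 * r)).
      { eapply Rle_trans; [exact B | ].
        replace (5 * (r * Cmod h * (r * Cmod h)) * exp (r * Cmod h)) with
          (5 * (Cmod h * Cmod h) * (r * r * exp (r * Cmod h))) by ring.
        apply Rmult_le_compat_l; [nra | ].
        replace (3 * r) with (r + r + r) by ring. rewrite !exp_plus.
        assert (e := exp_ineq1_le r).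
        apply Rmult_le_compat; [nra | left; apply exp_pos | apply Rmult_le_compat; lra | ].
        apply exp_le. nra. }
      apply Rle_trans with (exp (- rpow r a + Cmod z * r) * (5 * (Cmod h * Cmod h) * exp (3 * r))).
      * apply Rmult_le_compat; [apply Cmod_ge_0 | apply Cmod_ge_0 | now apply Cmod_ray_integrand | exact B'].
      * specialize (Hexp r Hr 3 ltac:(lra)).
        replace (exp (- rpow r a + Cmod z * r) * (5 * (Cmod h * Cmod h) * exp (3 * r))) with
          (5 * (Cmod h * Cmod h) * (exp (- rpow r a + Cmod z * r) * exp (3 * r))) by ring.
        rewrite (Rmult_assoc (5 * _) K).
        apply Rmult_le_compat_l; [nra | exact Hexp].
    + exact Hg.
  - replace (5 * (Cmod h * Cmod h) * K) with ((5 * K * Cmod h) * Cmod h) by ring.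
    apply Rmult_le_compat_r; [exact Hh0 | ].
    apply Rmult_lt_compat_l with (r := 5 * K) in Hh2; [ | lra].
    replace (5 * K * (eps / (5 * K))) with eps in Hh2 by (field; lra). lra.
Qed.

(** * Agreement with the integral over the half-line *)

Definition F0_integrand (a : R) (z : C) (t : R) : C :=
  Cexp (Ci * RtoC (rpow t a) - Ci * z * RtoC t)%C.

Lemma continuous_F0_integrand (a : R) (z : C) (t : R) : 1 < a ->
  continuousC (F0_integrand a z) t.
Proof.
  intros Ha.
  apply (continuous_ext (T := R_UniformSpace) (U := C_R_NormedModule)
    (fun t => Cexp (Ci * RtoC (rpow t a) + (- Ci * z) * RtoC t + 0)%C)).
  - intros s. unfold F0_integrand. f_equal. ring.
  - apply (continuousC_Cexp_affine (fun r => rpow r a)). apply continuous_rpow. lra.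
Qed.

(** The sine is the cosine shifted by [- PI / 2], which puts the imaginary part
    in the form of a real part. *)
Lemma rayU_cos_sin (a x y th r : R) :
  (exp (rayX a x y th r) * cos (rayY a x y th r),
   exp (rayX a x y th r) * sin (rayY a x y th r))
  = (rayU a x y 0 th r, rayU a x y (- (PI / 2)) th r).
Proof.
  unfold rayU. f_equal; f_equal.
  - f_equal. ring.
  - rewrite sin_cos, cos_plus, cos_plus, !sin_neg, !cos_neg, sin_PI2, cos_PI2. ring.
Qed.

Lemma F0_integrand_rayU (a : R) (z : C) (r : R) :
  F0_integrand a z r = (rayU a (Re z) (Im z) 0 0 r, rayU a (Re z) (Im z) (- (PI / 2)) 0 r).
Proof.
  rewrite <- rayU_cos_sin. unfold F0_integrand, Cexp.
  replace (Re _) with (rayX a (Re z) (Im z) 0 r).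
  replace (Im (_ - _)%C) with (rayY a (Re z) (Im z) 0 r).
  - reflexivity.
  - unfold rayY, Re, Im; simpl. rewrite Rmult_0_r, cos_0, sin_0. ring.
  - unfold rayX, Re, Im; simpl. rewrite Rmult_0_r, cos_0, sin_0. ring.
Qed.

Lemma ray_integrand_rayU (a : R) (z : C) (r : R) : 1 < a ->
  ray_integrand a z r =
  (rayU a (Re z) (Im z) 0 (PI / (2 * a)) r, rayU a (Re z) (Im z) (- (PI / 2)) (PI / (2 * a)) r).
Proof.
  intros Ha. rewrite <- rayU_cos_sin. unfold ray_integrand, Cexp.
  assert (H1 : a * (PI / (2 * a)) = PI / 2) by (field; lra).
  replace (Re _) with (rayX a (Re z) (Im z) (PI / (2 * a)) r).
  replace (Im (_ + _)%C) with (rayY a (Re z) (Im z) (PI / (2 * a)) r).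
  - reflexivity.
  - unfold rayY, ray_dir, ray_angle, Re, Im; simpl. rewrite H1, cos_PI2. ring.
  - unfold rayX, ray_dir, ray_angle, Re, Im; simpl. rewrite H1, sin_PI2. ring.
Qed.

Lemma RIntC_pair (f : R -> C) (u v : R -> R) (b c : R) :
  (forall t, continuousC f t) -> (forall t, f t = (u t, v t)) ->
  RIntC f b c = (RInt u b c, RInt v b c).
Proof.
  intros Hc E. assert (H := is_RIntC_continuous f b c Hc).
  assert (H1 := is_RInt_fct_extend_fst (U := R_NormedModule) (V := R_NormedModule) f b c _ H).
  assert (H2 := is_RInt_fct_extend_snd (U := R_NormedModule) (V := R_NormedModule) f b c _ H).
  assert (U1 : RInt u b c = fst (RIntC f b c)).
  { apply is_RInt_unique. apply (is_RInt_ext (V := R_NormedModule) (fun t => fst (f t)));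
      [ | exact H1]. intros t _. now rewrite E. }
  assert (U2 : RInt v b c = snd (RIntC f b c)).
  { apply is_RInt_unique. apply (is_RInt_ext (V := R_NormedModule) (fun t => snd (f t)));
      [ | exact H2]. intros t _. now rewrite E. }
  rewrite U1, U2. apply surjective_pairing.
Qed.

(** The partial integrals along the two rays differ by at most
    [T exp (- m T)] times a constant, componentwise by [ray_rotation]. *)
Lemma F_ray_agrees (a : R) (z : C) : 1 < a -> Im z < 0 ->
  is_RInt_infty (F0_integrand a z) 0 (F_ray a z).
Proof.
  intros Ha Hz. apply is_RInt_infty_intro with (fun T => RIntC (F0_integrand a z) 0 T).
  { intros T _. apply is_RIntC_continuous. intros t. now apply continuous_F0_integrand. }
  assert (H1 : tends_to (fun T => RIntC (ray_integrand a z) 0 T) (F_ray a z)).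
  { apply is_RInt_infty_elim with (ray_integrand a z) 0; [ | now apply F_ray_correct].
    intros T _. apply is_RIntC_continuous. intros t. now apply continuous_ray_integrand. }
  set (m := - (Im z * cos (PI / (2 * a)))).
  assert (Hm : 0 < m).
  { assert (HPI := PI_RGT_0).
    assert (0 < PI / (2 * a)) by (apply Rdiv_lt_0_compat; lra).
    assert (a * (PI / (2 * a)) = PI / 2) by (field; lra).
    assert (0 < cos (PI / (2 * a))) by (apply cos_gt_0; nra).
    unfold m. nra. }
  destruct (rpow_superlinear a (Rabs (Re z)) Ha) as [T0 [HT0 HT]].
  assert (H2 : tends_to (fun T => (RIntC (F0_integrand a z) 0 T - RIntC (ray_integrand a z) 0 T)%C) 0).
  { apply tends_to_0_bound with (fun T => T * exp (T * - m) * (2 * (PI / (2 * a)))) T0;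
      [ | now apply is_lim_T_exp].
    intros T HTT.
    assert (B : forall phi, Rabs (RInt (rayU a (Re z) (Im z) phi (PI / (2 * a))) 0 T
        - RInt (rayU a (Re z) (Im z) phi 0) 0 T) <= T * exp (T * - m) * (PI / (2 * a))).
    { intros phi. unfold m. rewrite Ropp_involutive. apply ray_rotation; try assumption; [lra | ].
      apply HT. lra. }
    rewrite (RIntC_pair (F0_integrand a z) (rayU a (Re z) (Im z) 0 0)
               (rayU a (Re z) (Im z) (- (PI / 2)) 0)).
    2:{ intros t. now apply continuous_F0_integrand. }
    2:{ intros t. apply F0_integrand_rayU. }
    rewrite (RIntC_pair (ray_integrand a z) (rayU a (Re z) (Im z) 0 (PI / (2 * a)))
               (rayU a (Re z) (Im z) (- (PI / 2)) (PI / (2 * a)))).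
    2:{ intros t. now apply continuous_ray_integrand. }
    2:{ intros t. now apply ray_integrand_rayU. }
    rewrite <- Cmod_opp.
    eapply Rle_trans; [apply Cmod_le_abs | ].
    assert (B1 := B 0). assert (B2 := B (- (PI / 2))).
    unfold Cminus, Cplus, Copp. cbn [fst snd].
    rewrite !Ropp_plus_distr, !Ropp_involutive.
    rewrite 2!(Rplus_comm (- _)). unfold Rminus in B1, B2. lra. }
  assert (H3 := tends_to_plus _ _ _ _ H1 H2). rewrite Cplus_0_r in H3.
  intros eps He. destruct (H3 eps He) as [M HM]. exists M. intros T HTM.
  specialize (HM T HTM).
  replace (RIntC (F0_integrand a z) 0 T - F_ray a z)%C with
    (RIntC (ray_integrand a z) 0 T
      + (RIntC (F0_integrand a z) 0 T - RIntC (ray_integrand a z) 0 T) - F_ray a z)%C; [exact HM | ].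
  generalize (RIntC (ray_integrand a z) 0 T) (RIntC (F0_integrand a z) 0 T).
  intros p q. change C in p, q. change ((p + (q - p) - F_ray a z)%C = (q - F_ray a z)%C). ring.
Qed.

Lemma F_ray_is_F0 (a : R) : 1 < a -> is_F0 a (F_ray a).
Proof.
  intros Ha. split; [now apply F_ray_entire | ]. intros z Hz. now apply F_ray_agrees.
Qed.

(** * Holomorphy of the continued transform *)

Lemma is_deriveCC_plus (f g : C -> C) (z df dg : C) :
  is_deriveCC f z df -> is_deriveCC g z dg -> is_deriveCC (fun w => (f w + g w)%C) z (df + dg)%C.
Proof. exact (is_derive_plus (V := C_NormedModule) f g z df dg). Qed.

(** [C] carries two structures of normed module over itself, with the same
    norm but different uniform structures; the product rule of the library is
    stated for the one that comes from the ring. *)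
Lemma is_deriveCC_ring (f : C -> C) (z l : C) :
  is_deriveCC f z l <->
  is_derive (K := C_AbsRing) (V := AbsRing_NormedModule C_AbsRing) f z l.
Proof.
  split.
  - intros [_ H]. split; [apply (is_linear_scal_l (V := AbsRing_NormedModule C_AbsRing) l) | exact H].
  - intros [_ H]. split; [apply (is_linear_scal_l (V := C_NormedModule) l) | exact H].
Qed.

Lemma is_deriveCC_mult (f g : C -> C) (z df dg : C) :
  is_deriveCC f z df -> is_deriveCC g z dg ->
  is_deriveCC (fun w => (f w * g w)%C) z (df * g z + f z * dg)%C.
Proof.
  intros Hf Hg. apply is_deriveCC_ring in Hf, Hg. apply is_deriveCC_ring.
  exact (is_derive_mult (K := C_AbsRing) f g z df dg Hf Hg Cmult_comm).
Qed.

Lemma is_deriveCC_const (c z : C) : is_deriveCC (fun _ => c) z (RtoC 0).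
Proof. exact (is_derive_const (V := C_NormedModule) c z). Qed.

(** The error of the linear approximation of [/ w] is exactly
    [(w - z)^2 / (w z^2)]. *)
Lemma is_deriveCC_inv (z : C) : z <> 0 -> is_deriveCC Cinv z (- / (z * z))%C.
Proof.
  intros Hz. apply is_deriveCC_intro. intros eps He.
  assert (Hm : 0 < Cmod z) by now apply Cmod_gt_0.
  set (m := Cmod z) in *.
  exists (Rmin (m / 2) (eps * (m * m * m) / 2)). split.
  { apply Rmin_pos; [lra | ]. apply Rdiv_lt_0_compat; [ | lra].
    apply Rmult_lt_0_compat; [lra | ]. apply Rmult_lt_0_compat; nra. }
  intros w Hw.
  assert (H1 : Cmod (w - z) < m / 2) by (eapply Rlt_le_trans; [exact Hw | apply Rmin_l]).
  assert (H2 : Cmod (w - z) < eps * (m * m * m) / 2) by (eapply Rlt_le_trans; [exact Hw | apply Rmin_r]).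
  assert (H0 := Cmod_ge_0 (w - z)).
  assert (Hwm : m / 2 <= Cmod w).
  { assert (T := Cmod_triangle w (- (w - z))). replace (w + - (w - z))%C with z in T by ring.
    rewrite Cmod_opp in T. fold m in T. lra. }
  assert (Hw0 : w <> 0) by (apply Cmod_gt_0; lra).
  replace (/ w - / z - (w - z) * - / (z * z))%C with ((w - z) * (w - z) * / (w * (z * z)))%C
    by (field; split; assumption).
  rewrite !Cmod_mult, Cmod_inv by (repeat apply Cmult_neq_0; assumption).
  rewrite !Cmod_mult. fold m.
  rewrite (Rmult_comm eps), Rmult_assoc. apply Rmult_le_compat_l; [exact H0 | ].
  assert (P : 0 < Cmod w * (m * m)) by (apply Rmult_lt_0_compat; nra).
  apply Rmult_le_reg_r with (Cmod w * (m * m)); [exact P | ].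
  rewrite Rmult_assoc, Rinv_l, Rmult_1_r by lra.
  assert (m / 2 * (eps * (m * m)) <= Cmod w * (eps * (m * m))).
  { apply Rmult_le_compat_r; [ | exact Hwm]. apply Rmult_le_pos; nra. }
  lra.
Qed.

Lemma is_deriveCC_reflect (f : C -> C) (s l : C) :
  is_deriveCC f (Ci * (1 - s))%C l -> is_deriveCC (fun w => f (Ci * (1 - w))%C) s (- Ci * l)%C.
Proof.
  intros H. apply is_deriveCC_intro. intros eps He.
  destruct (is_deriveCC_elim _ _ _ H eps He) as [d [Hd Hw]]. exists d. split; [exact Hd | ].
  intros w Hws.
  assert (E : (Ci * (1 - w) - Ci * (1 - s))%C = (- Ci * (w - s))%C) by ring.
  assert (E' : Cmod (Ci * (1 - w) - Ci * (1 - s)) = Cmod (w - s)).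
  { rewrite E, Cmod_mult, Cmod_opp, Cmod_Ci. ring. }
  specialize (Hw (Ci * (1 - w))%C). rewrite E' in Hw. specialize (Hw Hws).
  replace ((w - s) * (- Ci * l))%C with ((Ci * (1 - w) - Ci * (1 - s)) * l)%C by ring. exact Hw.
Qed.

(** Conjugating both the argument and the value preserves complex
    differentiability, although conjugation itself is not holomorphic. *)
Lemma is_deriveCC_conj (f : C -> C) (s l : C) :
  is_deriveCC f (Cconj s) l -> is_deriveCC (fun w => Cconj (f (Cconj w))) s (Cconj l).
Proof.
  intros H. apply is_deriveCC_intro. intros eps He.
  destruct (is_deriveCC_elim _ _ _ H eps He) as [d [Hd Hw]]. exists d. split; [exact Hd | ].
  intros w Hws. specialize (Hw (Cconj w)).
  rewrite <- Cminus_conj, Cmod_conj in Hw. specialize (Hw Hws).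
  replace (Cconj (f (Cconj w)) - Cconj (f (Cconj s)) - (w - s) * Cconj l)%C with
    (Cconj (f (Cconj w) - f (Cconj s) - Cconj (w - s) * l))%C; [now rewrite Cmod_conj | ].
  now rewrite !Cminus_conj, Cmult_conj, Cminus_conj, !Cconj_conj.
Qed.

(** The Mellin transform without the term [1 / (s - 1)], written so that only
    [/ s] and entire functions occur. *)
Definition Mellin_regular (F : C -> C) (s : C) : C :=
  (- / s + (F (Ci * (1 - s)) + Cconj (F (Ci * (1 - Cconj s)))) * (/ 2 * / s))%C.

Lemma Mellin_regular_holomorphic (F : C -> C) :
  entire F -> holomorphic_on (fun s => 0 < Re s) (Mellin_regular F).
Proof.
  intros HF s Hs.
  assert (Hs0 : s <> 0) by (intros ->; simpl in Hs; lra).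
  destruct (HF (Ci * (1 - s))%C I) as [l1 H1]. destruct (HF (Ci * (1 - Cconj s))%C I) as [l2 H2].
  assert (D1 := is_deriveCC_reflect F s l1 H1).
  assert (D2 := is_deriveCC_conj (fun w => F (Ci * (1 - w))%C) s _ (is_deriveCC_reflect F (Cconj s) l2 H2)).
  assert (D3 := is_deriveCC_inv s Hs0).
  assert (D4 := is_deriveCC_mult _ _ _ _ _ (is_deriveCC_const (/ 2)%C s) D3).
  assert (D5 := is_deriveCC_mult _ _ _ _ _ (is_deriveCC_plus _ _ _ _ _ D1 D2) D4).
  assert (D6 := is_deriveCC_mult _ _ _ _ _ (is_deriveCC_const (- (1))%C s) D3).
  assert (D7 := is_deriveCC_plus _ _ _ _ _ D6 D5).
  eexists. eapply (is_derive_ext (K := C_AbsRing) (V := C_NormedModule)); [ | exact D7].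
  intros w. unfold Mellin_regular.
  change ((- (1) * / w + (F (Ci * (1 - w)) + Cconj (F (Ci * (1 - Cconj w)))) * (/ 2 * / w))%C
    = (- / w + (F (Ci * (1 - w)) + Cconj (F (Ci * (1 - Cconj w)))) * (/ 2 * / w))%C). ring.
Qed.

(** * The function S *)

Definition S_density (a u : R) : R := 1 + cos (rpow (ln u) a).

Lemma S_density_bounds (a u : R) : 0 <= S_density a u <= 2.
Proof. unfold S_density. assert (h := COS_bound (rpow (ln u) a)). lra. Qed.

Lemma continuous_S_density (a u : R) : 0 < a -> 0 < u -> continuous (S_density a) u.
Proof.
  intros Ha Hu.
  apply (continuous_plus (fun _ => 1) (fun u => cos (rpow (ln u) a))); [apply continuous_const | ].
  apply (continuous_comp (fun u => rpow (ln u) a) cos); [ | apply continuous_cos].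
  apply (continuous_comp ln (fun t => rpow t a)); [ | now apply continuous_rpow].
  apply (ex_derive_continuous (V := R_NormedModule) ln). auto_derive. exact Hu.
Qed.

Lemma ex_RInt_S_density (a x y : R) : 0 < a -> 0 < x -> 0 < y -> ex_RInt (S_density a) x y.
Proof.
  intros Ha Hx Hy. apply (ex_RInt_continuous (V := R_CompleteNormedModule)).
  intros u Hu. apply continuous_S_density; [exact Ha | ].
  eapply Rlt_le_trans; [ | apply Hu]. now apply Rmin_pos.
Qed.

Lemma S_alpha_diff (a x y : R) : 0 < a -> 0 < x -> 0 < y ->
  S_alpha a y = S_alpha a x + RInt (S_density a) x y.
Proof.
  intros Ha Hx Hy. symmetry.
  apply (RInt_Chasles (V := R_CompleteNormedModule)); apply ex_RInt_S_density; lra.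
Qed.

Lemma S_alpha_1 (a : R) : S_alpha a 1 = 0.
Proof. exact (RInt_point (V := R_CompleteNormedModule) 1 _). Qed.

Lemma S_alpha_nondecr (a : R) : 0 < a -> nondecr_from1 (S_alpha a).
Proof.
  intros Ha x y Hx Hxy. rewrite (S_alpha_diff a x y) by lra.
  assert (0 <= RInt (S_density a) x y); [ | lra].
  apply RInt_ge_0; [exact Hxy | apply ex_RInt_S_density; lra | ].
  intros u _. apply S_density_bounds.
Qed.

Lemma S_alpha_nonneg (a : R) : 0 < a -> nonneg_from1 (S_alpha a).
Proof.
  intros Ha x Hx. rewrite <- (S_alpha_1 a). apply S_alpha_nondecr; lra.
Qed.

Lemma S_alpha_le (a x : R) : 0 < a -> 1 <= x -> S_alpha a x <= 2 * x.
Proof.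
  intros Ha Hx. apply Rle_trans with (RInt (fun _ => 2) 1 x).
  - apply RInt_le; [exact Hx | apply ex_RInt_S_density; lra | apply ex_RInt_const | ].
    intros u _. apply S_density_bounds.
  - rewrite RInt_const. unfold scal; simpl. unfold mult; simpl. lra.
Qed.

Lemma is_derive_S_alpha (a x : R) : 0 < a -> 0 < x ->
  is_derive (S_alpha a) x (S_density a x).
Proof.
  intros Ha Hx. apply (is_derive_RInt (V := R_NormedModule) (S_density a) (S_alpha a) 1).
  - exists (mkposreal x Hx). intros y Hy.
    apply (RInt_correct (V := R_CompleteNormedModule)). apply ex_RInt_S_density; [exact Ha | lra | ].
    unfold ball in Hy; simpl in Hy. unfold AbsRing_ball, abs, minus, plus, opp in Hy; simpl in Hy.
    apply Rabs_def2 in Hy. lra.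
  - now apply continuous_S_density.
Qed.

(** * Complex powers *)

Lemma cpow_plus (x : R) (w v : C) : cpow x (w + v)%C = (cpow x w * cpow x v)%C.
Proof. unfold cpow. rewrite <- Cexp_plus. f_equal. ring. Qed.

Lemma cpow_RtoC (x y : R) : cpow x (RtoC y) = RtoC (exp (y * ln x)).
Proof.
  unfold cpow, Cexp, Re, Im, RtoC. simpl.
  replace (y * 0 + 0 * ln x) with 0 by ring. rewrite cos_0, sin_0.
  f_equal; [ | ring]. rewrite Rmult_1_r. f_equal. ring.
Qed.

Lemma cpow_1 (x : R) : 0 < x -> cpow x 1 = RtoC x.
Proof. intros Hx. rewrite cpow_RtoC, Rmult_1_l, exp_ln by exact Hx. reflexivity. Qed.

Lemma cpow_m1 (x : R) : 0 < x -> cpow x (- (1))%C = RtoC (/ x).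
Proof.
  intros Hx. rewrite <- RtoC_opp, cpow_RtoC.
  replace (- (1) * ln x) with (- ln x) by ring. now rewrite exp_Ropp, exp_ln.
Qed.

Lemma cpow_base_1 (w : C) : cpow 1 w = RtoC 1.
Proof. unfold cpow. rewrite ln_1, Cmult_0_r. apply Cexp_0. Qed.

Lemma Cmod_cpow (x : R) (w : C) : Cmod (cpow x w) = exp (Re w * ln x).
Proof. unfold cpow. rewrite Cmod_Cexp. f_equal. apply re_scal_r. Qed.

Lemma is_deriveC_cpow (x : R) (w : C) : 0 < x ->
  is_deriveC (fun x => cpow x w) x (w * RtoC (/ x) * cpow x w)%C.
Proof.
  intros Hx. apply is_deriveC_Cexp.
  replace (w * RtoC (/ x))%C with (0 * RtoC (ln x) + w * RtoC (/ x))%C by ring.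
  apply (is_deriveC_mult (fun _ => w) (fun x => RtoC (ln x))); [apply is_deriveC_const | ].
  apply (is_deriveC_RtoC ln). auto_derive; [exact Hx | ring].
Qed.

Lemma is_lim_exp_ln (m c : R) : 0 < m -> is_lim (fun x => c * exp (- m * ln x)) p_infty 0.
Proof.
  intros Hm. apply is_lim_spec. intros eps. assert (He := cond_pos eps).
  assert (Hc := Rabs_pos c).
  set (d := eps / (Rabs c + 1)).
  assert (Hd : 0 < d) by (apply Rdiv_lt_0_compat; lra).
  exists (exp (- ln d / m)). intros x Hx.
  rewrite Rminus_0_r, Rabs_mult, (Rabs_pos_eq (exp _)) by (left; apply exp_pos).
  assert (H1 : - ln d / m < ln x).
  { rewrite <- (ln_exp (- ln d / m)). apply ln_increasing; [apply exp_pos | exact Hx]. }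
  assert (H2 : - m * ln x < ln d).
  { apply Rmult_lt_compat_l with (r := m) in H1; [ | exact Hm].
    replace (m * (- ln d / m)) with (- ln d) in H1 by (field; lra). lra. }
  apply exp_increasing in H2. rewrite exp_ln in H2 by exact Hd.
  apply Rle_lt_trans with (Rabs c * d).
  - apply Rmult_le_compat_l; lra.
  - unfold d. apply Rmult_lt_reg_r with (Rabs c + 1); [lra | ].
    replace (Rabs c * (eps / (Rabs c + 1)) * (Rabs c + 1)) with (Rabs c * eps) by (field; lra). nra.
Qed.

(** * The Mellin transform *)

Definition F0_partial (a : R) (z : C) (T : R) : C := RIntC (F0_integrand a z) 0 T.

Lemma is_deriveC_F0_partial (a : R) (z : C) (x : R) : 1 < a -> 0 < x ->
  is_deriveC (fun x => F0_partial a z (ln x)) x (RtoC (/ x) * F0_integrand a z (ln x))%C.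
Proof.
  intros Ha Hx.
  assert (H : is_deriveC (F0_partial a z) (ln x) (F0_integrand a z (ln x))).
  { apply (is_derive_RInt (V := C_R_NormedModule) (F0_integrand a z) (F0_partial a z) 0).
    - exists (mkposreal 1 Rlt_0_1). intros T _. apply is_RIntC_continuous.
      intros t. now apply continuous_F0_integrand.
    - now apply continuous_F0_integrand. }
  assert (L : is_derive ln x (/ x)) by (auto_derive; [exact Hx | ring]).
  assert (D := is_derive_comp (V := C_R_NormedModule) _ _ _ _ _ H L).
  rewrite scal_R_Cmult in D. exact D.
Qed.

(** Since [-i (i (1 - s)) = 1 - s], this is where the point [i (1 - s)] comes from. *)
Lemma F0_integrand_ln (a x : R) (s : C) :
  F0_integrand a (Ci * (1 - s))%C (ln x) = (Cexp (Ci * RtoC (rpow (ln x) a)) * cpow x (1 - s))%C.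
Proof.
  unfold F0_integrand, cpow. rewrite <- Cexp_plus. f_equal.
  assert (E : (Ci * Ci = - (1))%C) by (unfold Ci, Cmult, Copp, RtoC; simpl; f_equal; ring).
  replace (Ci * (Ci * (1 - s)) * RtoC (ln x))%C with ((Ci * Ci) * (1 - s) * RtoC (ln x))%C by ring.
  rewrite E. ring.
Qed.

Lemma cpow_conj (x : R) (w : C) : Cconj (cpow x w) = cpow x (Cconj w).
Proof.
  unfold cpow. rewrite Cexp_conj, Cmult_conj. do 2 f_equal.
  unfold Cconj, RtoC; simpl. f_equal. ring.
Qed.

Lemma Cexp_Ci_sum (t : R) :
  (Cexp (Ci * RtoC t) + Cconj (Cexp (Ci * RtoC t)))%C = RtoC (2 * cos t).
Proof.
  unfold Cexp, Cconj, Cplus, Re, Im, RtoC; simpl.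
  replace (0 * t - 1 * 0) with 0 by ring. replace (0 * 0 + 1 * t) with t by ring.
  rewrite exp_0. f_equal; ring.
Qed.

(** The primitive of [S x * x ^ (- s - 1)] obtained from one integration by
    parts and the substitution [x = e ^ t]. *)
Definition Mellin_primitive (a : R) (s : C) (x : R) : C :=
  (RtoC (S_alpha a x) * cpow x (- s) * (- / s)
   + / s * ((1 + - cpow x (1 - s)) * / (s - 1)
            + / 2 * (F0_partial a (Ci * (1 - s)) (ln x)
                     + Cconj (F0_partial a (Ci * (1 - Cconj s)) (ln x)))))%C.

Lemma is_deriveC_scal (c : C) (f : R -> C) (x : R) (df : C) :
  is_deriveC f x df -> is_deriveC (fun t => (c * f t)%C) x (c * df)%C.
Proof.
  intros H. replace (c * df)%C with (0 * f x + c * df)%C by ring.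
  apply (is_deriveC_mult (fun _ => c) f); [apply is_deriveC_const | exact H].
Qed.

Lemma is_deriveC_scal_r (c : C) (f : R -> C) (x : R) (df : C) :
  is_deriveC f x df -> is_deriveC (fun t => (f t * c)%C) x (df * c)%C.
Proof.
  intros H. replace (df * c)%C with (df * c + f x * 0)%C by ring.
  apply (is_deriveC_mult f (fun _ => c)); [exact H | apply is_deriveC_const].
Qed.

Lemma is_deriveC_opp (f : R -> C) (x : R) (df : C) :
  is_deriveC f x df -> is_deriveC (fun t => (- f t)%C) x (- df)%C.
Proof. exact (is_derive_opp (V := C_R_NormedModule) f x df). Qed.

Lemma Re_gt_1_neq (s : C) : 1 < Re s -> s <> 0 /\ (s - 1)%C <> 0.
Proof.
  intros Hs. split; intros E.
  - rewrite E in Hs. simpl in Hs. lra.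
  - apply Ceq_minus in E. rewrite E in Hs. simpl in Hs. lra.
Qed.

(** Since [Cexp (i u)] and its conjugate add up to [2 cos u], the second summand
    of the primitive has derivative [S' x * x^(-s) / s]; this cancels the term
    with [S'] in the derivative of the first summand. *)
Lemma Mellin_primitive_derive (a : R) (s : C) (x : R) : 1 < a -> 1 < Re s -> 0 < x ->
  is_deriveC (Mellin_primitive a s) x (RtoC (S_alpha a x) * cpow x (- s - 1))%C.
Proof.
  intros Ha Hs Hx. destruct (Re_gt_1_neq s Hs) as [Hs0 Hs1].
  assert (D1 := is_deriveC_mult _ _ _ _ _
                  (is_deriveC_RtoC _ _ _ (is_derive_S_alpha a x ltac:(lra) Hx))
                  (is_deriveC_cpow x (- s)%C Hx)).
  assert (D2 := is_deriveC_plus _ _ _ _ _ (is_deriveC_const 1 x)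
                  (is_deriveC_opp _ _ _ (is_deriveC_cpow x (1 - s)%C Hx))).
  assert (D3 := is_deriveC_F0_partial a (Ci * (1 - s))%C x Ha Hx).
  assert (D4 := is_deriveC_conj _ _ _ (is_deriveC_F0_partial a (Ci * (1 - Cconj s))%C x Ha Hx)).
  assert (D := is_deriveC_plus _ _ _ _ _ (is_deriveC_scal_r (- / s)%C _ _ _ D1)
    (is_deriveC_scal (/ s)%C _ _ _ (is_deriveC_plus _ _ _ _ _ (is_deriveC_scal_r (/ (s - 1))%C _ _ _ D2)
       (is_deriveC_scal (/ 2)%C _ _ _ (is_deriveC_plus _ _ _ _ _ D3 D4))))).
  cbv beta in D.
  replace (RtoC (S_alpha a x) * cpow x (- s - 1))%C with
    ((RtoC (S_density a x) * cpow x (- s) + RtoC (S_alpha a x) * (- s * RtoC (/ x) * cpow x (- s))) * (- / s)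
     + / s * ((0 + - ((1 - s) * RtoC (/ x) * cpow x (1 - s))) * / (s - 1)
        + / 2 * (RtoC (/ x) * F0_integrand a (Ci * (1 - s)) (ln x)
                 + Cconj (RtoC (/ x) * F0_integrand a (Ci * (1 - Cconj s)) (ln x)))))%C; [exact D | ].
  rewrite Cmult_conj, !F0_integrand_ln, Cmult_conj, cpow_conj.
  replace (Cconj (1 - Cconj s)) with (1 - s)%C
    by (rewrite Cminus_conj, Cconj_conj; f_equal; unfold Cconj, RtoC; simpl; f_equal; ring).
  replace (Cconj (RtoC (/ x))) with (RtoC (/ x)) by (unfold Cconj, RtoC; simpl; f_equal; ring).
  set (e := Cexp (Ci * RtoC (rpow (ln x) a))).
  assert (E : (e + Cconj e)%C = RtoC (2 * cos (rpow (ln x) a))) by apply Cexp_Ci_sum.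
  replace (RtoC (S_density a x)) with (1 + / 2 * (e + Cconj e))%C.
  2:{ rewrite E. unfold S_density. rewrite RtoC_plus, RtoC_mult. field. }
  replace (1 - s)%C with (- s + 1)%C by ring.
  replace (- s - 1)%C with (- s + - (1))%C by ring.
  rewrite !cpow_plus, cpow_1, cpow_m1 by exact Hx.
  assert (Ex : (RtoC (/ x) * RtoC x)%C = 1) by (rewrite <- RtoC_mult; f_equal; field; lra).
  replace (RtoC (/ x) * (e * (cpow x (- s) * RtoC x)))%C with (RtoC (/ x) * RtoC x * e * cpow x (- s))%C by ring.
  replace (RtoC (/ x) * (Cconj e * (cpow x (- s) * RtoC x)))%C with (RtoC (/ x) * RtoC x * Cconj e * cpow x (- s))%C by ring.
  replace ((- s + 1) * RtoC (/ x) * (cpow x (- s) * RtoC x))%C with ((- s + 1) * (RtoC (/ x) * RtoC x) * cpow x (- s))%C by ring.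
  rewrite Ex.
  field; repeat split; assumption.
Qed.

Lemma Mellin_primitive_1 (a : R) (s : C) : Mellin_primitive a s 1 = 0.
Proof.
  unfold Mellin_primitive, F0_partial. rewrite S_alpha_1, ln_1, !cpow_base_1.
  assert (E : forall f : R -> C, RIntC f 0 0 = RtoC 0).
  { intros f. exact (RInt_point (V := C_R_CompleteNormedModule) 0 f). }
  rewrite !E.
  replace (Cconj 0) with (RtoC 0) by (unfold Cconj, RtoC; simpl; f_equal; ring). ring.
Qed.

(** The boundary terms vanish because [S x <= 2 x] and [Re s > 1]. *)
Lemma Mellin_primitive_lim (a : R) (s : C) (F : C -> C) :
  1 < a -> is_F0 a F -> 1 < Re s ->
  tends_to (Mellin_primitive a s)
    (/ s * (/ (s - 1) + / 2 * (F (Ci * (1 - s)) + Cconj (F (Ci * (1 - Cconj s))))))%C.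
Proof.
  intros Ha HF Hs.
  assert (L : forall z, Im z < 0 -> tends_to (fun x => F0_partial a z (ln x)) (F z)).
  { intros z Hz. apply (tends_to_comp (F0_partial a z) ln); [ | exact is_lim_ln_p].
    apply is_RInt_infty_elim with (F0_integrand a z) 0; [ | now apply HF].
    intros b _. apply is_RIntC_continuous. intros t. now apply continuous_F0_integrand. }
  assert (L1 := L (Ci * (1 - s))%C ltac:(unfold Im; simpl; unfold Re in Hs; lra)).
  assert (L2 := tends_to_conj _ _ (L (Ci * (1 - Cconj s))%C ltac:(unfold Im; simpl; unfold Re in Hs; lra))).
  assert (M0 : 0 < Re s - 1) by lra.
  assert (L3 : tends_to (fun x => cpow x (1 - s)%C) 0).
  { apply tends_to_0_bound with (fun x => 1 * exp (- (Re s - 1) * ln x)) 1.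
    - intros x Hx. rewrite Cmod_cpow. right. rewrite Rmult_1_l. f_equal. f_equal.
      unfold Re; simpl. ring.
    - now apply is_lim_exp_ln. }
  assert (L4 : tends_to (fun x => (RtoC (S_alpha a x) * cpow x (- s))%C) 0).
  { apply tends_to_0_bound with (fun x => 2 * exp (- (Re s - 1) * ln x)) 1.
    - intros x Hx. rewrite Cmod_mult, Cmod_R, Cmod_cpow.
      rewrite Rabs_pos_eq by (apply S_alpha_nonneg; lra).
      replace (2 * exp (- (Re s - 1) * ln x)) with (2 * x * exp (Re (- s)%C * ln x)).
      + apply Rmult_le_compat_r; [left; apply exp_pos | apply S_alpha_le; lra].
      + rewrite <- (exp_ln x) at 1 by lra. rewrite Rmult_assoc, <- exp_plus.
        do 2 f_equal. unfold Re; simpl. ring.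
    - now apply is_lim_exp_ln. }
  assert (A := tends_to_plus _ _ _ _ (tends_to_scal (- / s)%C _ _ L4)
    (tends_to_scal (/ s)%C _ _ (tends_to_plus _ _ _ _
       (tends_to_scal (/ (s - 1))%C _ _ (tends_to_plus _ _ _ _ (tends_to_const 1) (tends_to_scal (- (1))%C _ _ L3)))
       (tends_to_scal (/ 2)%C _ _ (tends_to_plus _ _ _ _ L1 L2))))).
  cbv beta in A.
  intros eps He. destruct (A eps He) as [M HM]. exists M. intros T HT. specialize (HM T HT).
  match type of HM with Cmod ?u < _ => match goal with |- Cmod ?v < _ => replace v with u; [exact HM | ] end end.
  unfold Mellin_primitive. ring.
Qed.

Lemma S_alpha_Mellin (a : R) (s : C) (F : C -> C) :
  1 < a -> is_F0 a F -> 1 < Re s ->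
  is_Mellin (S_alpha a) s
    (1 / (s - 1) - 1 / s + (F (Ci * (1 - s)) + Cconj (F (Ci * (1 - Cconj s)))) / (2 * s))%C.
Proof.
  intros Ha HF Hs. destruct (Re_gt_1_neq s Hs) as [Hs0 Hs1].
  apply is_RInt_infty_intro with (Mellin_primitive a s).
  - intros b Hb.
    replace (Mellin_primitive a s b) with (Mellin_primitive a s b - Mellin_primitive a s 1)%C
      by (rewrite Mellin_primitive_1; ring).
    apply (is_RInt_derive (V := C_R_CompleteNormedModule) (Mellin_primitive a s)
             (fun x => (RtoC (S_alpha a x) * cpow x (- s - 1))%C)).
    + intros x Hx. rewrite Rmin_left in Hx by exact Hb. apply Mellin_primitive_derive; lra.
    + intros x Hx. rewrite Rmin_left in Hx by exact Hb.
      apply (ex_derive_continuous (V := C_R_NormedModule)). eexists.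
      apply (is_deriveC_mult (fun x => RtoC (S_alpha a x)) (fun x => cpow x (- s - 1)%C)).
      * apply is_deriveC_RtoC, is_derive_S_alpha; lra.
      * apply is_deriveC_cpow. lra.
  - replace (1 / (s - 1) - 1 / s + (F (Ci * (1 - s)) + Cconj (F (Ci * (1 - Cconj s)))) / (2 * s))%C
      with (/ s * (/ (s - 1) + / 2 * (F (Ci * (1 - s)) + Cconj (F (Ci * (1 - Cconj s))))))%C.
    + now apply Mellin_primitive_lim.
    + field; repeat split; assumption.
Qed.

Lemma S_alpha_Mellin_extends (a sigma : R) :
  1 < a -> 0 <= sigma -> Mellin_extends (S_alpha a) 1 sigma.
Proof.
  intros Ha Hsig. exists (Mellin_regular (F_ray a)). split.
  - intros s Hs. apply (Mellin_regular_holomorphic (F_ray a)); [now apply F_ray_entire | lra].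
  - intros s Hs. destruct (Re_gt_1_neq s Hs) as [Hs0 Hs1].
    eexists. split; [apply (S_alpha_Mellin a s (F_ray a)); try assumption; now apply F_ray_is_F0 | ].
    unfold Mellin_regular. field; repeat split; assumption.
Qed.

(** * Asymptotic expansion *)

Lemma derive_comparison (f g df dg : R -> R) (t0 t : R) :
  (forall s, t0 <= s -> is_derive f s (df s)) ->
  (forall s, t0 <= s -> is_derive g s (dg s)) ->
  (forall s, t0 <= s -> Rabs (df s) <= dg s) ->
  t0 <= t -> Rabs (f t - f t0) <= g t - g t0.
Proof.
  intros Hf Hg H Ht.
  assert (Mono : forall h dh : R -> R, (forall s, t0 <= s -> is_derive h s (dh s)) ->
            (forall s, t0 <= s -> 0 <= dh s) -> h t0 <= h t).
  { intros h dh Hh Hp. destruct (MVT_gen h t0 t dh) as [c [Hc E]].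
    - intros s Hs. apply Hh. rewrite Rmin_left in Hs by exact Ht. lra.
    - intros s Hs. rewrite Rmin_left in Hs by exact Ht. apply continuity_pt_filterlim.
      apply (ex_derive_continuous (V := R_NormedModule) h). exists (dh s). apply Hh. lra.
    - rewrite Rmin_left in Hc by exact Ht. assert (h1 := Hp c ltac:(lra)). nra. }
  apply Rabs_le. split.
  - assert (h := Mono (fun s => plus (g s) (f s)) (fun s => plus (dg s) (df s))).
    unfold plus in h; simpl in h.
    assert (g t0 + f t0 <= g t + f t); [ | lra]. apply h.
    + intros s Hs. apply (is_derive_plus (V := R_NormedModule) g f); [now apply Hg | now apply Hf].
    + intros s Hs. assert (b := H s Hs). assert (b' := Rle_abs (- df s)). rewrite Rabs_Ropp in b'. lra.
  - assert (h := Mono (fun s => minus (g s) (f s)) (fun s => minus (dg s) (df s))).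
    unfold minus, plus, opp in h; simpl in h.
    assert (g t0 + - f t0 <= g t + - f t); [ | lra]. apply h.
    + intros s Hs. apply (is_derive_minus (V := R_NormedModule) g f); [now apply Hg | now apply Hf].
    + intros s Hs. assert (b := H s Hs). assert (b' := Rle_abs (df s)). lra.
Qed.

(** Reciprocal of the derivative of the phase [t^a]. *)
Definition inv_freq (a t : R) : R := / (a * rpow t (a - 1)).

Lemma inv_freq_pos (a t : R) : 0 < a -> 0 < t -> 0 < inv_freq a t.
Proof.
  intros Ha Ht. apply Rinv_0_lt_compat, Rmult_lt_0_compat; [exact Ha | ].
  rewrite rpow_pos by exact Ht. apply Rpower_gt_0.
Qed.

Lemma is_derive_inv_freq (a t : R) : 1 < a -> 0 < t ->
  is_derive (inv_freq a) t (- (a - 1) * inv_freq a t / t).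
Proof.
  intros Ha Ht. assert (H := is_derive_rpow_pos t (a - 1) Ht).
  assert (Hp : 0 < rpow t (a - 1)) by (rewrite rpow_pos by exact Ht; apply Rpower_gt_0).
  assert (Hn : a * rpow t (a - 1) <> 0) by nra.
  assert (D := is_derive_inv _ _ _ (is_derive_scal _ _ a _ H) Hn).
  replace (- (a - 1) * inv_freq a t / t) with
    (- (a * ((a - 1) * rpow t (a - 1 - 1))) / (a * rpow t (a - 1)) ^ 2); [exact D | ].
  unfold inv_freq.
  replace (rpow t (a - 1 - 1)) with (rpow t (a - 1) / t); [field; lra | ].
  rewrite !rpow_pos by exact Ht. unfold Rdiv.
  rewrite <- (Rpower_1 t) at 2 by exact Ht.
  rewrite <- Rpower_Ropp, <- Rpower_plus. f_equal.
Qed.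

(** The result of two integrations by parts of [e^t cos (tau t)], where
    [tau' = 1 / k]. The two subtracted oscillating terms are chosen so that in
    the derivative everything cancels except [- cos tau] times the derivative
    of [e^t k^2 (1 - p / t)]. *)
Lemma two_term_expansion_derive (Sg tau k : R -> R) (p t : R) :
  0 < t -> 0 < k t ->
  is_derive Sg t (exp t * (1 + cos (tau t))) ->
  is_derive tau t (/ k t) ->
  is_derive k t (- p * k t / t) ->
  is_derive (fun t => Sg t - exp t - exp t * k t * sin (tau t)
                      - exp t * (k t * k t) * (1 - p / t) * cos (tau t)) t
    (- cos (tau t) * (exp t * (k t * k t) * ((1 - p / t) * (1 - 2 * p / t) + p / (t * t)))).
Proof.
  intros Ht Hk DS Dtau Dk.
  auto_derive.
  - repeat split; try (eexists; eassumption); lra.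
  - replace (Derive (fun x => Sg x) t) with (exp t * (1 + cos (tau t)))
      by (symmetry; apply is_derive_unique, DS).
    replace (Derive (fun x => tau x) t) with (/ k t) by (symmetry; apply is_derive_unique, Dtau).
    replace (Derive (fun x => k x) t) with (- p * k t / t) by (symmetry; apply is_derive_unique, Dk).
    field. lra.
Qed.

(** For [t >= 4 p] the derivative of [e^t k^2] is at least half of the function,
    which is why it can serve as its own majorant. *)
Lemma majorant_derive (k : R -> R) (p t : R) :
  0 < t -> is_derive k t (- p * k t / t) ->
  is_derive (fun t => exp t * (k t * k t)) t (exp t * (k t * k t) * (1 - 2 * p / t)).
Proof.
  intros Ht Dk.
  auto_derive.
  - repeat split; try (eexists; eassumption); lra.
  - replace (Derive (fun x => k x) t) with (- p * k t / t) by (symmetry; apply is_derive_unique, Dk).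
    field. lra.
Qed.
(** The error [D] of the two-term expansion satisfies [|D'| <= K0 B <= 2 K0 B']
    for the majorant [B = e^t k^2], hence is [O(B)] by comparison; the second
    term of the expansion is itself bounded by [B]. *)
Lemma S_alpha_expansion_exp (a : R) : 1 < a ->
  exists K T, 0 < K /\ 1 <= T /\ forall t, T <= t ->
    Rabs (S_alpha a (exp t) - exp t - exp t * inv_freq a t * sin (rpow t a))
    <= K * (exp t * (inv_freq a t * inv_freq a t)).
Proof.
  intros Ha. set (p := a - 1). set (k := inv_freq a).
  set (B := fun t => exp t * (k t * k t)).
  set (D := fun t => S_alpha a (exp t) - exp t - exp t * k t * sin (rpow t a)
                     - exp t * (k t * k t) * (1 - p / t) * cos (rpow t a)).
  set (T := Rmax 1 (4 * p)).
  assert (Hp : 0 < p) by (unfold p; lra).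
  assert (HT1 : 1 <= T) by apply Rmax_l. assert (HT2 : 4 * p <= T) by apply Rmax_r.
  assert (Hk : forall t, 0 < t -> 0 < k t) by (intros t Ht; apply inv_freq_pos; lra).
  assert (HB : forall t, 0 < t -> 0 < B t).
  { intros t Ht. specialize (Hk t Ht). apply Rmult_lt_0_compat; [apply exp_pos | nra]. }
  assert (Dk : forall t, 0 < t -> is_derive k t (- p * k t / t)).
  { intros t Ht. now apply is_derive_inv_freq. }
  assert (Dtau : forall t, 0 < t -> is_derive (fun t => rpow t a) t (/ k t)).
  { intros t Ht. unfold k, inv_freq. rewrite Rinv_inv. now apply is_derive_rpow_pos. }
  assert (DS : forall t, is_derive (fun t => S_alpha a (exp t)) t (exp t * (1 + cos (rpow t a)))).
  { intros t. assert (E : is_derive exp t (exp t)) by (auto_derive; [trivial | ring]).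
    assert (d := is_derive_comp (S_alpha a) exp t _ _
                   (is_derive_S_alpha a (exp t) ltac:(lra) (exp_pos t)) E).
    unfold S_density in d. rewrite ln_exp in d. exact d. }
  set (K0 := (1 + p) * (1 + 2 * p) + p).
  assert (HK0 : 0 < K0) by (unfold K0; nra).
  assert (Hquot : forall t, T <= t -> 0 <= p / t <= / 4 /\ 0 <= p / (t * t) <= p).
  { intros t Ht. repeat split.
    - apply Rmult_le_pos; [lra | left; apply Rinv_0_lt_compat; lra].
    - apply Rmult_le_reg_r with t; [lra | ]. unfold Rdiv. rewrite Rmult_assoc, Rinv_l by lra. lra.
    - apply Rmult_le_pos; [lra | left; apply Rinv_0_lt_compat; nra].
    - apply Rmult_le_reg_r with (t * t); [nra | ]. unfold Rdiv. rewrite Rmult_assoc, Rinv_l by nra.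
      assert (1 <= t * t) by nra. nra. }
  assert (Cmp : forall t, T <= t -> Rabs (D t - D T) <= 2 * K0 * B t - 2 * K0 * B T).
  { intros t Ht.
    apply (derive_comparison D (fun t => 2 * K0 * B t)
      (fun t => - cos (rpow t a) * (B t * ((1 - p / t) * (1 - 2 * p / t) + p / (t * t))))
      (fun t => 2 * K0 * (B t * (1 - 2 * p / t)))).
    - intros s Hs. apply (two_term_expansion_derive (fun t => S_alpha a (exp t)) (fun t => rpow t a) k p s).
      + lra.
      + apply Hk; lra.
      + apply DS.
      + apply Dtau; lra.
      + apply Dk; lra.
    - intros s Hs. apply (is_derive_scal B). apply majorant_derive; [lra | apply Dk; lra].
    - intros s Hs. destruct (Hquot s Hs) as [Q1 Q2].
      assert (HBs := HB s ltac:(lra)).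
      replace (2 * p / s) with (2 * (p / s)) by (field; lra).
      rewrite !Rabs_mult, Rabs_Ropp, (Rabs_pos_eq (B s)) by lra.
      assert (C : Rabs (cos (rpow s a)) <= 1) by apply Rabs_le, COS_bound.
      assert (C0 := Rabs_pos (cos (rpow s a))).
      set (q := p / s) in *. set (r := p / (s * s)) in *.
      assert (E : Rabs ((1 - q) * (1 - 2 * q) + r) <= K0).
      { apply Rabs_le. unfold K0. split; nra. }
      assert (E0 := Rabs_pos ((1 - q) * (1 - 2 * q) + r)).
      apply Rle_trans with (1 * (B s * K0)).
      + apply Rmult_le_compat; [exact C0 | nra | exact C | ]. apply Rmult_le_compat_l; lra.
      + assert (0 < B s * K0) by nra. nra.
    - exact Ht. }
  assert (HBT := HB T ltac:(lra)).
  exists (2 * K0 + Rabs (D T) / B T + 1), T. repeat split.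
  - assert (0 <= Rabs (D T) / B T); [ | lra].
    apply Rmult_le_pos; [apply Rabs_pos | left; now apply Rinv_0_lt_compat].
  - exact HT1.
  - intros t Ht. assert (c := Cmp t Ht). assert (HBt := HB t ltac:(lra)).
    destruct (Hquot t Ht) as [Q1 _].
    assert (BT : B T <= B t).
    { assert (0 <= 2 * K0 * B t - 2 * K0 * B T); [ | nra].
      eapply Rle_trans; [apply Rabs_pos | exact c]. }
    assert (E1 : Rabs (D T) <= Rabs (D T) / B T * B t).
    { replace (Rabs (D T)) with (Rabs (D T) / B T * B T) at 1 by (field; lra).
      apply Rmult_le_compat_l; [ | exact BT].
      apply Rmult_le_pos; [apply Rabs_pos | left; now apply Rinv_0_lt_compat]. }
    assert (E2 : Rabs (B t * (1 - p / t) * cos (rpow t a)) <= B t).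
    { rewrite !Rabs_mult, (Rabs_pos_eq (B t)), (Rabs_pos_eq (1 - p / t)) by lra.
      assert (C : Rabs (cos (rpow t a)) <= 1) by apply Rabs_le, COS_bound.
      assert (C0 := Rabs_pos (cos (rpow t a))).
      assert (0 <= 1 - p / t <= 1) by lra.
      assert ((1 - p / t) * Rabs (cos (rpow t a)) <= 1) by nra.
      rewrite Rmult_assoc. nra. }
    assert (E3 := Rabs_triang (D t - D T) (D T)).
    assert (E4 := Rabs_triang (D t - D T + D T) (B t * (1 - p / t) * cos (rpow t a))).
    assert (E5 : 0 < 2 * K0 * B T) by nra.
    assert (E : Rabs (D t - D T + D T + B t * (1 - p / t) * cos (rpow t a))
                <= (2 * K0 + Rabs (D T) / B T + 1) * B t).
    { rewrite !Rmult_plus_distr_r, Rmult_1_l. lra. }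
    replace (D t - D T + D T + B t * (1 - p / t) * cos (rpow t a)) with
      (S_alpha a (exp t) - exp t - exp t * k t * sin (rpow t a)) in E
      by (unfold D, B; ring).
    exact E.
Qed.

Lemma S_alpha_expansion (a : R) : 1 < a ->
  bigO_infty
    (fun x => S_alpha a x - (x + x * sin (rpow (ln x) a) / (a * rpow (ln x) (a - 1))))
    (fun x => x / rpow (ln x) (2 * (a - 1))).
Proof.
  intros Ha. destruct (S_alpha_expansion_exp a Ha) as [K [T [HK [HT H]]]].
  exists (K * / (a * a)). exists (exp T). intros x Hx.
  assert (Hx0 : 0 < x) by (assert (h := exp_pos T); lra).
  assert (HL : T < ln x) by (rewrite <- (ln_exp T); apply ln_increasing; [apply exp_pos | exact Hx]).
  specialize (H (ln x) ltac:(lra)). rewrite exp_ln in H by exact Hx0.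
  set (L := ln x) in *.
  assert (Hq : 0 < rpow L (a - 1)) by (rewrite rpow_pos by lra; apply Rpower_gt_0).
  assert (E : rpow L (2 * (a - 1)) = rpow L (a - 1) * rpow L (a - 1)).
  { rewrite !rpow_pos by lra. rewrite <- Rpower_plus. f_equal. ring. }
  rewrite E.
  replace (S_alpha a x - (x + x * sin (rpow L a) / (a * rpow L (a - 1)))) with
    (S_alpha a x - x - x * inv_freq a L * sin (rpow L a)) by (unfold inv_freq; field; lra).
  eapply Rle_trans; [exact H | ]. right.
  rewrite Rabs_pos_eq.
  - unfold inv_freq. field. lra.
  - left. apply Rdiv_lt_0_compat; [exact Hx0 | now apply Rmult_lt_0_compat].
Qed.

(** * Failure of the conjecture *)

Lemma phase_peak (a T : R) : 1 < a -> 0 < T -> exists t, T < t /\ sin (rpow t a) = 1.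
Proof.
  intros Ha HT. assert (HPI := PI_RGT_0).
  destruct (INR_unbounded (Rpower T a / (2 * PI))) as [n Hn].
  set (y := PI / 2 + 2 * INR n * PI).
  assert (Hn' : Rpower T a < 2 * INR n * PI).
  { apply Rmult_gt_compat_r with (r := 2 * PI) in Hn; [ | lra].
    replace (Rpower T a / (2 * PI) * (2 * PI)) with (Rpower T a) in Hn by (field; lra). lra. }
  assert (Hy : Rpower T a < y) by (unfold y; lra).
  assert (HTa := Rpower_gt_0 T a).
  exists (Rpower y (/ a)). split.
  - assert (E : T = Rpower (Rpower T a) (/ a)).
    { rewrite Rpower_mult, Rinv_r by lra. now rewrite Rpower_1. }
    rewrite E at 1. apply Rlt_Rpower_l; [apply Rinv_0_lt_compat; lra | lra].
  - rewrite rpow_pos by apply Rpower_gt_0. rewrite Rpower_root by lra.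
    unfold y. rewrite sin_period. apply sin_PI2.
Qed.

Lemma ln_le_linear (m : R) : 0 < m -> exists T, 1 <= T /\ forall t, T <= t -> ln t <= m * t.
Proof.
  intros Hm. assert (L := is_lim_div_ln_p). apply is_lim_spec in L.
  destruct (L (mkposreal m Hm)) as [M HM]. simpl in HM.
  exists (Rmax 1 (M + 1)). split; [apply Rmax_l | ]. intros t Ht.
  assert (h := Rmax_l 1 (M + 1)). assert (h' := Rmax_r 1 (M + 1)).
  specialize (HM t ltac:(lra)). rewrite Rminus_0_r in HM. apply Rabs_def2 in HM.
  destruct HM as [HM _]. apply Rmult_lt_compat_r with (r := t) in HM; [ | lra].
  replace (ln t / t * t) with (ln t) in HM by (field; lra). lra.
Qed.

(** At a point [x = e^t] with [sin (t^a) = 1], put [q = t^(a-1)]. The expansion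
    and the assumed bound give
    [x / (a q) <= |K| x^beta + K1 x / (a q)^2], and [q^2 <= x^(1 - beta)] for
    large [t], so [q] stays bounded, whereas it tends to infinity. *)
Lemma S_alpha_not_power_close (a beta : R) : 1 < a -> beta < 1 ->
  ~ bigO_infty (fun x => S_alpha a x - 1 * x) (fun x => Rpower x beta).
Proof.
  intros Ha Hb [K [M HM]].
  destruct (S_alpha_expansion_exp a Ha) as [K1 [T1 [HK1 [HT1 H1]]]].
  set (m := 1 - beta). set (p := a - 1).
  destruct (ln_le_linear (m / (2 * p))) as [T2 [HT2 H2]].
  { apply Rdiv_lt_0_compat; unfold m, p; lra. }
  set (A := a * (Rabs K + K1)).
  assert (HK := Rabs_pos K).
  assert (HA : 0 < A) by (unfold A; nra).
  set (T3 := Rpower A (/ p)).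
  assert (HT3 := Rpower_gt_0 A (/ p)). fold T3 in HT3.
  set (T := Rabs M + T1 + T2 + T3). assert (HM0 := Rabs_pos M). assert (HM1 := Rle_abs M).
  destruct (phase_peak a T Ha ltac:(unfold T; lra)) as [t [Ht Hs]].
  assert (Htt : M < t /\ T1 <= t /\ T2 <= t /\ T3 < t) by (unfold T in Ht; lra).
  destruct Htt as [G1 [G2 [G3 G4]]].
  assert (Hx : M < exp t) by (assert (h := exp_ineq1_le t); lra).
  specialize (HM (exp t) Hx). specialize (H1 t G2). specialize (H2 t G3).
  rewrite Hs in H1.
  set (q := rpow t p).
  assert (Hq : A < q).
  { unfold q. rewrite rpow_pos by lra. rewrite <- (Rpower_root A p) by (unfold p; lra).
    apply Rlt_Rpower_l; [unfold p; lra | ]. fold T3. lra. }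
  assert (Hqq : q * q <= exp (m * t)).
  { unfold q. rewrite rpow_pos by lra. unfold Rpower. rewrite <- exp_plus. apply exp_le.
    apply Rmult_le_compat_l with (r := 2 * p) in H2; [ | unfold p; lra].
    replace (2 * p * (m / (2 * p) * t)) with (m * t) in H2 by (field; unfold p; lra). lra. }
  rewrite (Rabs_pos_eq (Rpower _ _)) in HM by (left; apply Rpower_gt_0).
  assert (EP : Rpower (exp t) beta * exp (m * t) = exp t).
  { unfold Rpower. rewrite ln_exp, <- exp_plus. f_equal. unfold m. ring. }
  assert (HP := Rpower_gt_0 (exp t) beta).
  assert (Hk : inv_freq a t = / (a * q)) by reflexivity.
  assert (Ex := exp_pos t).
  (* The main term is at most the sum of the two error terms. *)
  assert (B : exp t * inv_freq a t
              <= Rabs K * Rpower (exp t) beta + K1 * (exp t * (inv_freq a t * inv_freq a t))).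
  { apply Rabs_le_between in H1. apply Rabs_le_between in HM.
    assert (K * Rpower (exp t) beta <= Rabs K * Rpower (exp t) beta)
      by (apply Rmult_le_compat_r; [lra | apply Rle_abs]).
    lra. }
  assert (Bq : Rpower (exp t) beta * (q * q) <= exp t).
  { rewrite <- EP at 2. apply Rmult_le_compat_l; lra. }
  rewrite Hk in B.
  apply Rmult_le_compat_r with (r := a * (q * q)) in B; [ | nra].
  replace (exp t * / (a * q) * (a * (q * q))) with (exp t * q) in B by (field; lra).
  replace ((Rabs K * Rpower (exp t) beta + K1 * (exp t * (/ (a * q) * / (a * q)))) * (a * (q * q)))
    with (a * (Rabs K * (Rpower (exp t) beta * (q * q))) + K1 * exp t / a) in B by (field; lra).
  assert (B1 : Rabs K * (Rpower (exp t) beta * (q * q)) <= Rabs K * exp t)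
    by (apply Rmult_le_compat_l; lra).
  assert (B2 : K1 * exp t / a <= a * (K1 * exp t)).
  { assert (0 < K1 * exp t) by nra.
    apply Rmult_le_reg_r with a; [lra | ].
    replace (K1 * exp t / a * a) with (K1 * exp t) by (field; lra).
    assert (1 <= a * a) by nra. nra. }
  assert (B3 : exp t * q <= exp t * A).
  { apply Rmult_le_compat_l with (r := a) in B1; [ | lra]. unfold A. lra. }
  apply Rmult_le_reg_l in B3; lra.
Qed.

Lemma S_alpha_refutes (a sigma0 : R) : 1 < a -> 0 < sigma0 < 1 ->
  tauberian_hyp sigma0 (S_alpha a) 1 /\
  ~ tauberian_concl sigma0 (S_alpha a) 1 /\
  ~ tauberian_conjecture sigma0.
Proof.
  intros Ha Hs.
  assert (H : tauberian_hyp sigma0 (S_alpha a) 1).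
  { split; [ | split].
    - apply S_alpha_nonneg. lra.
    - apply S_alpha_nondecr. lra.
    - apply S_alpha_Mellin_extends; lra. }
  assert (N : ~ tauberian_concl sigma0 (S_alpha a) 1).
  { intros C. (* This makes the exponent equal to [(sigma0 + 5) / 6 < 1]. *)
    specialize (C ((1 - sigma0) / 6) ltac:(lra)).
    revert C. apply S_alpha_not_power_close; lra. }
  split; [exact H | ]. split; [exact N | ].
  intros C. apply N, (C _ _ H).
Qed.

Theorem mainTheorem8 (alpha : R) (halpha : 1 < alpha) :
  nonneg_from1 (S_alpha alpha) /\
  nondecr_from1 (S_alpha alpha) /\
  (exists F : C -> C, is_F0 alpha F /\
     forall s : C, 1 < Re s ->
       is_Mellin (S_alpha alpha) s
         (1 / (s - 1) - 1 / s
          + (F (Ci * (1 - s)) + Cconj (F (Ci * (1 - Cconj s)))) / (2 * s))%C) /\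
  Mellin_extends (S_alpha alpha) 1 0 /\
  bigO_infty
    (fun x => S_alpha alpha x
              - (x + x * sin (rpow (ln x) alpha)
                     / (alpha * rpow (ln x) (alpha - 1))))
    (fun x => x / rpow (ln x) (2 * (alpha - 1))) /\
  (forall sigma0 : R, 0 < sigma0 < 1 ->
     tauberian_hyp sigma0 (S_alpha alpha) 1 /\
     ~ tauberian_concl sigma0 (S_alpha alpha) 1 /\
     ~ tauberian_conjecture sigma0).
Proof.
  split; [apply S_alpha_nonneg; lra | ].
  split; [apply S_alpha_nondecr; lra | ].
  split.
  { exists (F_ray alpha). assert (HF := F_ray_is_F0 alpha halpha). split; [exact HF | ].
    intros s Hs. now apply S_alpha_Mellin. }
  split; [apply S_alpha_Mellin_extends; lra | ].
  split; [now apply S_alpha_expansion | ].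
  intros sigma0 Hs. now apply S_alpha_refutes.
Qed.
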